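(* There is an algorithm that solves \textsc{Class Domination Coloring} in $O^*(2^{O(2^k k q\log q)})$ time, where $k=|M|$ for a cluster vertex deletion set $M$ of the input graph (given as input) and $q$ is the number of connected components of $G-M$.
   Context: All graphs are finite and simple; $N_G[v]=N_G(v)\cup\{v\}$. A coloring $\chi:V(G)\to C$ is proper if adjacent vertices get different colors; $|\chi|$ is the number of colors used. A vertex $v$ dominates a set $S$ if $S\subseteq N_G[v]$. A CD coloring of $G$ is a proper coloring $\chi$ such that for every color $c$ in the image of $\chi$ there is a vertex $v\in V(G)$ dominating the color class $\chi^{-1}(c)$. \textsc{Class Domination Coloring} (CD Coloring): given a graph $G$ and integer $\ell$, decide whether $G$ has a CD coloring $\chi$ with $|\chi|\le\ell$. A cluster vertex deletion set is $M\subseteq V(G)$ such that every connected component of $G-M$ is a clique. $O^*(\cdot)$ hides factors polynomial in the input size.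
   Formalization: In the exponent 2^k k q log q, q is read as max(q,2): for q = 0 the logarithm is undefined, and for q = 1 the exponent would vanish and claim polynomial time for this NP-hard problem on arbitrary graphs. *)

(* Defs.v *)
From mathcomp Require Import all_boot all_order all_algebra.

Set Implicit Arguments.
Unset Strict Implicit.
Unset Printing Implicit Defensive.

(** * Graphs and class domination colorings *)

Definition simple_graph (T : finType) (e : rel T) : Prop :=
  symmetric e /\ irreflexive e.

Definition closed_nbh (T : finType) (e : rel T) (v : T) : {set T} :=
  [set u | e v u] :|: [set v].

Definition dominates (T : finType) (e : rel T) (v : T) (S : {set T}) : bool :=
  S \subset closed_nbh e v.

Definition proper_coloring (T C : finType) (e : rel T) (chi : T -> C) : Prop :=
  forall u v, e u v -> chi u <> chi v.

Definition colors (T C : finType) (chi : T -> C) : {set C} :=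
  [set chi v | v : T].

Definition color_class (T C : finType) (chi : T -> C) (c : C) : {set T} :=
  [set v | chi v == c].

Definition cd_coloring (T C : finType) (e : rel T) (chi : T -> C) : Prop :=
  proper_coloring e chi /\
  forall c, c \in colors chi -> exists v, dominates e v (color_class chi c).

Definition cd_colorable (T : finType) (e : rel T) (l : int) : Prop :=
  exists (C : finType) (chi : T -> C),
    cd_coloring e chi /\ (#|colors chi|%:Z <= l)%R.

(** * Cluster vertex deletion sets *)

(* The edge relation of G - M, seen as a relation on V(G). *)
Definition del_rel (T : finType) (e : rel T) (M : {set T}) : rel T :=
  fun u v => [&& u \notin M, v \notin M & e u v].

Definition components (T : finType) (e : rel T) (M : {set T}) : {set {set T}} :=
  equivalence_partition (connect (del_rel e M)) (~: M).

Definition clique (T : finType) (e : rel T) (A : {set T}) : Prop :=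
  {in A &, forall u v, u <> v -> e u v}.

Definition cluster_deletion_set (T : finType) (e : rel T) (M : {set T}) : Prop :=
  forall A, A \in components e M -> clique e A.

(** * Random access machine *)

(* Structured programs for a unit-cost RAM with indirect addressing whose only
   arithmetic is addition and truncated subtraction.  One step lengthens the
   longest stored number by at most one bit, so running times are polynomially
   related to those of Turing machines; multiplication is left out because at
   unit cost it would break this.  Arguments of the constructors are
   addresses, except for the constant stored by [CConst]. *)
Inductive cmd : Type :=
  | CSkip
  | CConst of nat & nat        (* m[i] := c *)
  | CAdd of nat & nat & nat    (* m[i] := m[j] + m[k] *)
  | CSub of nat & nat & nat    (* m[i] := m[j] - m[k] *)
  | CRead of nat & nat         (* m[i] := m[m[j]] *)
  | CWrite of nat & nat        (* m[m[i]] := m[j] *)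
  | CSeq of cmd & cmd
  | CIf of nat & cmd & cmd     (* first branch when m[i] > 0 *)
  | CWhile of nat & cmd.       (* loop as long as m[i] > 0 *)

Definition memory := nat -> nat.

Definition upd (m : memory) (i x : nat) : memory :=
  fun j => if j == i then x else m j.

(* [exec p m t m']: started in [m], [p] halts in [m'] after exactly [t] steps;
   every elementary instruction and every test costs one step. *)
Inductive exec : cmd -> memory -> nat -> memory -> Prop :=
  | ExecSkip m : exec CSkip m 1 m
  | ExecConst m i c : exec (CConst i c) m 1 (upd m i c)
  | ExecAdd m i j k : exec (CAdd i j k) m 1 (upd m i (m j + m k))
  | ExecSub m i j k : exec (CSub i j k) m 1 (upd m i (m j - m k))
  | ExecRead m i j : exec (CRead i j) m 1 (upd m i (m (m j)))
  | ExecWrite m i j : exec (CWrite i j) m 1 (upd m (m i) (m j))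
  | ExecSeq p1 p2 m m1 m2 t1 t2 :
      exec p1 m t1 m1 -> exec p2 m1 t2 m2 -> exec (CSeq p1 p2) m (t1 + t2) m2
  | ExecIfT i p1 p2 m m' t :
      0 < m i -> exec p1 m t m' -> exec (CIf i p1 p2) m t.+1 m'
  | ExecIfF i p1 p2 m m' t :
      m i = 0 -> exec p2 m t m' -> exec (CIf i p1 p2) m t.+1 m'
  | ExecWhileT i p m m1 m2 t1 t2 :
      0 < m i -> exec p m t1 m1 -> exec (CWhile i p) m1 t2 m2 ->
      exec (CWhile i p) m (t1 + t2).+1 m2
  | ExecWhileF i p m : m i = 0 -> exec (CWhile i p) m 1 m.

Lemma exec_det p m t1 m1 t2 m2 :
  exec p m t1 m1 -> exec p m t2 m2 -> t1 = t2 /\ m1 = m2.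
Proof.
move=> h; elim: h t2 m2 => {p m t1 m1}; intros; match goal with
  | h : exec _ _ ?t ?m |- _ = ?t /\ _ = ?m => inversion h; subst end;
  repeat match goal with
  | z : ?m ?i = 0, p : is_true (0 < ?m ?i) |- _ => by move: p; rewrite z
  | IH : forall t m', exec ?p ?m t m' -> _, h : exec ?p ?m _ _ |- _ =>
      case: (IH _ _ h) => ? ?; subst; clear IH
  end; by [].
Qed.

(* The input occupies the first cells; all other cells hold 0. *)
Definition init_mem (w : seq nat) : memory := nth 0 w.

(* Number of bits; 0 is written with one bit. *)
Definition input_size (w : seq nat) : nat :=
  \sum_(x <- w) (trunc_log 2 x).+1.

(* The answer is read in cell 0 and nonzero means "yes". *)
Definition decides_within (p : cmd) (w : seq nat) (P : Prop) (T : nat) : Prop :=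
  exists (t : nat) (m : memory),
    [/\ exec p (init_mem w) t m, 0 < m 0 <-> P & t <= T].

(* Number of vertices, sign and absolute value of [l], characteristic vector of
   [M], adjacency matrix in row-major order. *)
Definition encode (n : nat) (e : rel 'I_n) (l : int) (M : {set 'I_n}) : seq nat :=
  [:: n; nat_of_bool (l < 0)%R; absz l]
  ++ [seq nat_of_bool (v \in M) | v <- enum 'I_n]
  ++ [seq nat_of_bool (e u v) | u <- enum 'I_n, v <- enum 'I_n].

(* q log q, with q read as 2 when q < 2: otherwise the exponent 2^k k q log q
   would vanish for q = 0 (M = V(G)) and q = 1, and the bound would claim
   polynomial time for arbitrary graphs.  For q >= 2 the rounded-down logarithm
   is within a factor 2 of log_2 q. *)
Definition qlogq (q : nat) : nat := maxn q 2 * trunc_log 2 (maxn q 2).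

(* Main.v *)
Require Import Defs.
From mathcomp Require Import all_boot all_order all_algebra.
From mathcomp Require Import zify ring.
From Stdlib Require Import Classical_Prop FunctionalExtensionality.

(** A color class disjoint from [M] meets each clique of [G - M] at most once, and
    is either a single vertex or dominated by a vertex of [M].  Once the classes
    meeting [M] are guessed up to true twins, it is therefore enough to choose
    the number [y v] of the other classes dominated by each [v] in [M]: by Hall's
    theorem with deficiency, the least number of vertices of a clique [Q] left as
    singletons is the maximum over [A] included in [M] of the number of vertices
    of [Q] with all their [M]-neighbours in [A], minus [y(A)].  The number of colors
    is then a convex piecewise linear function of [y] whose pieces are separated
    by hyperplanes with coefficients in [{-1, 0, 1}].  Any displacement longer than
    [2 ^ (12 * 2 ^ k)] splits into two shorter ones lying on the same side of all
    these hyperplanes, so a point that is optimal in a box of that radius is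
    optimal.  Local search started at [y = 0], where the value is at most [n], thus
    needs at most [n] improvements, each found by exhausting the box.

    On the machine side, the algorithm is written in a language of pure
    expressions all of whose loops are cut off after [X] rounds for one global
    number [X], so that running times are bounded by a fixed power of [X]. *)

Set Implicit Arguments.
Unset Strict Implicit.
Unset Printing Implicit Defensive.

Import Order.TTheory GRing.Theory Num.Theory.

(** * A language of bounded loops and its compiler *)

Inductive expr : Type :=
  | EX
  | EVar of nat
  | ECst of nat
  | EIn of expr
  | EAdd of expr & expr
  | ESub of expr & expr
  | EIf of expr & expr & expr
  | EIter of expr & expr & expr
  | ELet of expr & expr
  | ERen of (nat -> nat) & expr.

Definition scons (x : nat) (s : nat -> nat) : nat -> nat :=
  fun i => if i is j.+1 then s j else x.

Fixpoint ev (X : nat) (w : memory) (s : nat -> nat) (e : expr) : nat :=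
  match e with
  | EX => X
  | EVar i => s i
  | ECst c => c
  | EIn a => w (ev X w s a)
  | EAdd a b => ev X w s a + ev X w s b
  | ESub a b => ev X w s a - ev X w s b
  | EIf c a b => if 0 < ev X w s c then ev X w s a else ev X w s b
  | EIter b e0 f =>
      iteri (minn (ev X w s b) X)
        (fun i acc => ev X w (scons i (scons acc s)) f) (ev X w s e0)
  | ELet a b => ev X w (scons (ev X w s a) s) b
  | ERen r a => ev X w (s \o r) a
  end.

Definition move (i j : nat) : cmd := CSeq (CConst i 0) (CAdd i i j).

(* Reads the input cell whose index is in register [d], by counting it down in
   [d.+1]: cells 3 to [K - 1] are no longer in memory, see [stash]. *)
Fixpoint lookup (bits : seq nat) (d i fuel : nat) : cmd :=
  if fuel is f.+1 then
    CIf d.+1 (CSeq (CSub d.+1 d.+1 d.+2) (lookup bits d i.+1 f))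
             (if i < 3 then CRead d d else CConst d (nth 0 bits (i - 3)))
  else CRead d d.

Fixpoint compile (K : nat) (bits : seq nat) (r : nat -> nat) (d : nat) (e : expr) : cmd :=
  match e with
  | EX => move d 3
  | EVar i => move d (r i)
  | ECst c => CConst d c
  | EIn a => CSeq (compile K bits r d a)
      (CSeq (move d.+1 d) (CSeq (CConst d.+2 1) (lookup bits d 0 K)))
  | EAdd a b => CSeq (compile K bits r d a)
      (CSeq (compile K bits r d.+1 b) (CAdd d d d.+1))
  | ESub a b => CSeq (compile K bits r d a)
      (CSeq (compile K bits r d.+1 b) (CSub d d d.+1))
  | EIf c a b => CSeq (compile K bits r d c)
      (CIf d (compile K bits r d a) (compile K bits r d b))
  | EIter b e0 f =>
      CSeq (CSeq (compile K bits r d b) (CSeq (CSub d.+1 d 3) (CSub d d d.+1)))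
     (CSeq (CSeq (compile K bits r d.+2 e0) (CConst d.+1 0))
     (CSeq (CWhile d
        (CSeq (compile K bits (scons d.+1 (scons d.+2 r)) d.+3 f)
        (CSeq (move d.+2 d.+3)
        (CSeq (CConst d.+3 1) (CSeq (CAdd d.+1 d.+1 d.+3) (CSub d d d.+3))))))
        (move d d.+2)))
  | ELet a b => CSeq (compile K bits r d a)
      (CSeq (compile K bits (scons d r) d.+1 b) (move d d.+1))
  | ERen f a => compile K bits (r \o f) d a
  end.

(* Bounds both the registers needed and, up to a factor, the exponent of the
   running time. *)
Fixpoint weight (e : expr) : nat :=
  match e with
  | EX | EVar _ | ECst _ => 1
  | EIn a => weight a + 3
  | EAdd a b | ESub a b | ELet a b => weight a + weight b + 1
  | EIf c a b => weight c + weight a + weight b + 1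
  | EIter b e0 f => weight b + weight e0 + weight f + 4
  | ERen _ a => weight a
  end.

Definition runs (p : cmd) (m : memory) (T : nat) (Q : memory -> Prop) : Prop :=
  exists t m', [/\ exec p m t m', t <= T & Q m'].

Lemma runs_seq p1 p2 m T1 T2 Q1 Q :
  runs p1 m T1 Q1 -> (forall m1, Q1 m1 -> runs p2 m1 T2 Q) ->
  runs (CSeq p1 p2) m (T1 + T2) Q.
Proof.
move=> [t1 [m1 [h1 le1 /[swap] /[apply]]]] [t2 [m2 [h2 le2 q]]].
by exists (t1 + t2), m2; split=> //; [apply: ExecSeq h1 h2 | apply: leq_add].
Qed.

Lemma runs_weak p m T T' (Q Q' : memory -> Prop) :
  runs p m T Q -> T <= T' -> (forall m', Q m' -> Q' m') -> runs p m T' Q'.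
Proof.
move=> [t [m' [h le q]]] leT QQ'; exists t, m'; split=> //; last exact: QQ'.
exact: leq_trans le leT.
Qed.

Lemma runs_havoc p m i v (Q : memory -> Prop) :
  exec p m 1 (upd m i v) ->
  (forall m', m' i = v -> (forall x, x != i -> m' x = m x) -> Q m') ->
  runs p m 1 Q.
Proof.
move=> h q; exists 1, (upd m i v); split=> //; apply: q; first by rewrite /upd eqxx.
by move=> x /negPf xi; rewrite /upd xi.
Qed.

Lemma runs_const i c m (Q : memory -> Prop) :
  (forall m', m' i = c -> (forall x, x != i -> m' x = m x) -> Q m') ->
  runs (CConst i c) m 1 Q.
Proof. exact: runs_havoc (ExecConst _ _ _). Qed.

Lemma runs_add i j k m (Q : memory -> Prop) :
  (forall m', m' i = m j + m k -> (forall x, x != i -> m' x = m x) -> Q m') ->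
  runs (CAdd i j k) m 1 Q.
Proof. exact: runs_havoc (ExecAdd _ _ _ _). Qed.

Lemma runs_sub i j k m (Q : memory -> Prop) :
  (forall m', m' i = m j - m k -> (forall x, x != i -> m' x = m x) -> Q m') ->
  runs (CSub i j k) m 1 Q.
Proof. exact: runs_havoc (ExecSub _ _ _ _). Qed.

Lemma runs_read i j m (Q : memory -> Prop) :
  (forall m', m' i = m (m j) -> (forall x, x != i -> m' x = m x) -> Q m') ->
  runs (CRead i j) m 1 Q.
Proof. exact: runs_havoc (ExecRead _ _ _). Qed.

Lemma runs_move i j m (Q : memory -> Prop) : j != i ->
  (forall m', m' i = m j -> (forall x, x != i -> m' x = m x) -> Q m') ->
  runs (move i j) m 2 Q.
Proof.
move=> ji q.
apply: (@runs_seq _ _ _ 1 1 (fun m1 => m1 i = 0 /\ forall x, x != i -> m1 x = m x)).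
  exact: runs_const.
move=> m1 [m1i m1E]; apply: runs_add => m2; rewrite m1i m1E // => m2i m2E.
by apply: q => // x xi; rewrite m2E // m1E.
Qed.

Lemma runs_if i p1 p2 m T Q :
  (0 < m i -> runs p1 m T Q) -> (m i = 0 -> runs p2 m T Q) ->
  runs (CIf i p1 p2) m T.+1 Q.
Proof.
case: (posnP (m i)) => mi h1 h2.
  by have [t [m' [h le q]]] := h2 mi; exists t.+1, m'; split=> //; apply: ExecIfF.
by have [t [m' [h le q]]] := h1 isT; exists t.+1, m'; split=> //; apply: ExecIfT.
Qed.

Lemma runs_while i p (Inv : nat -> memory -> Prop) T r m :
  (forall r m, Inv r m -> m i = r) ->
  (forall r m, Inv r.+1 m -> runs p m T (Inv r)) ->
  Inv r m -> runs (CWhile i p) m (r * T.+1 + 1) (Inv 0).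
Proof.
move=> Invi step; elim: r m => [|r IHr] m inv.
  by exists 1, m; split=> //; apply/ExecWhileF/Invi.
have [t [m1 [h le /IHr [t' [m2 [h' le' q]]]]]] := step _ _ inv.
exists (t + t').+1, m2; split=> //; last by lia.
by apply: ExecWhileT h h'; rewrite (Invi _ _ inv).
Qed.

Definition agree (d K : nat) (m m' : memory) : Prop :=
  forall j, (j < d) || (K <= j) -> m' j = m j.

Lemma agree_trans d K m m1 m2 :
  agree d K m m1 -> agree d K m1 m2 -> agree d K m m2.
Proof. by move=> h1 h2 j hj; rewrite h2 ?h1. Qed.

Lemma agree_change d K m m' i :
  d <= i < K -> (forall x, x != i -> m' x = m x) -> agree d K m m'.
Proof. by move=> di h j hj; apply: h; lia. Qed.

Section Compile.

Variables (K X : nat) (w : memory) (bits : seq nat).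
Hypothesis bitsP : forall i, 3 <= i < K -> nth 0 bits (i - 3) = w i.

Definition ready (m : memory) : Prop :=
  [/\ m 3 = X, m 4 = 0, forall i, i < 3 -> m i = w i & forall i, K <= i -> m i = w i].

Lemma ready_agree d m m' : 5 <= d -> agree d K m m' -> ready m -> ready m'.
Proof.
move=> d5 h [m3 m4 mlo mhi]; split; first by rewrite h //; lia.
- by rewrite h //; lia.
- by move=> i i3; rewrite h ?mlo //; lia.
- by move=> i Ki; rewrite h ?mhi //; lia.
Qed.

Lemma lookup_ok d f i m v : 5 <= d -> d.+2 < K -> ready m -> i + f = K ->
  m d = v -> i <= v -> m d.+1 = v - i -> m d.+2 = 1 ->
  runs (lookup bits d i f) m (2 * f + 1) (fun m' => m' d = w v /\ agree d K m m').
Proof.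
move=> d5 dK; elim: f i m => [|f IHf] i m rdy ifK md iv md1 md2 /=.
  apply: runs_read => m' m'd m'E; split; last by apply: agree_change m'E; lia.
  by case: rdy => _ _ _ mhi; rewrite m'd md mhi //; lia.
have -> : 2 * f.+1 + 1 = (1 + (2 * f + 1)).+1 by lia.
apply: runs_if => [pos | zero].
  apply: (@runs_seq _ _ _ 1 _ (fun m1 => m1 d.+1 = m d.+1 - m d.+2 /\
     forall x, x != d.+1 -> m1 x = m x)); first exact: runs_sub.
  move=> m1 [m1d1 m1E].
  have ag : agree d K m m1 by apply: agree_change m1E; lia.
  apply: (runs_weak (IHf i.+1 m1 _ _ _ _ _ _)) => //; try lia.
  - exact: ready_agree ag rdy.
  - by rewrite m1E //; lia.
  - by rewrite m1E //; lia.
  - by move=> m' [-> h]; split=> //; apply: (agree_trans ag h).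
have -> : v = i by lia.
case: ltnP => i3.
  apply: (@runs_weak _ _ 1) => //; last by move=> ?; exact.
  apply: runs_read => m' m'd m'E; split; last by apply: agree_change m'E; lia.
  by case: rdy => _ _ mlo _; rewrite m'd md; have -> : v = i by [lia]; rewrite mlo.
apply: (@runs_weak _ _ 1) => //; last by move=> ?; exact.
apply: runs_const => m' m'd m'E; split; last by apply: agree_change m'E; lia.
by rewrite m'd bitsP //; lia.
Qed.

Let unit_cost := 2 * K + 20.
Let cost n := unit_cost * n * X.+1 ^ n.

Lemma cost_mono n N : n <= N -> cost n <= unit_cost * n * X.+1 ^ N.
Proof. by move=> nN; rewrite leq_mul2l leq_pexp2l ?orbT. Qed.

Lemma costE N : cost N = unit_cost * N * X.+1 ^ N.
Proof. by []. Qed.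

Lemma unit_cost_pow N : 2 * K + 20 <= unit_cost * X.+1 ^ N.
Proof. by rewrite leq_pmulr // expn_gt0. Qed.

Lemma compile_ok e r d m s :
  5 <= d -> d + weight e <= K -> ready m -> (forall i, r i < d /\ m (r i) = s i) ->
  runs (compile K bits r d e) m (cost (weight e))
    (fun m' => m' d = ev X w s e /\ agree d K m m').
Proof.
have c1 : 20 <= cost 1 by rewrite /cost muln1; have := unit_cost_pow 1; lia.
elim: e r d m s => [|i|c|a IHa|a IHa b IHb|a IHa b IHb|c IHc a IHa b IHb
  |b IHb e0 IH0 f IHf|a IHa b IHb|f a IHa] r d m s d5 dK rdy rP /=; move: dK => /= dK.
- apply: (@runs_weak _ _ 2 _ _ _ _ _ (fun m' q => q)); last by lia.
  apply: runs_move; first by lia.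
  move=> m' m'd m'E; split; last by apply: agree_change m'E; lia.
  by case: rdy => <-.
- apply: (@runs_weak _ _ 2 _ _ _ _ _ (fun m' q => q)); last by lia.
  have [ri mri] := rP i.
  apply: runs_move; first by lia.
  move=> m' m'd m'E; split; last by apply: agree_change m'E; lia.
  by rewrite m'd.
- apply: (@runs_weak _ _ 1 _ _ _ _ _ (fun m' q => q)); last by lia.
  by apply: runs_const => m' m'd m'E; split=> //; apply: agree_change m'E; lia.
- have leT : cost (weight a) + (2 + (1 + (2 * K + 1))) <= cost (weight a + 3).
    have := cost_mono (leq_addr 3 (weight a)); have := unit_cost_pow (weight a + 3).
    by rewrite [cost (_ + 3)]costE mulnDr mulnDl; move: (cost _) => c; nia.
  apply: runs_weak leT (fun m' q => q).
  apply: runs_seq; first by apply: IHa => //; lia.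
  move=> m1 [m1d ag1]; have rdy1 := ready_agree d5 ag1 rdy.
  apply: (@runs_seq _ _ _ _ _ (fun m2 => m2 d.+1 = m1 d /\
    forall x, x != d.+1 -> m2 x = m1 x)); first by apply: runs_move => //; lia.
  move=> m2 [m2d1 m2E].
  apply: (@runs_seq _ _ _ _ _ (fun m3 => m3 d.+2 = 1 /\
    forall x, x != d.+2 -> m3 x = m2 x)); first exact: runs_const.
  move=> m3 [m3d2 m3E].
  have ag3 : agree d K m1 m3.
    apply: (@agree_trans _ _ _ m2) => //; first by apply: agree_change m2E; lia.
    by apply: agree_change m3E; lia.
  apply: (runs_weak (@lookup_ok d K 0 m3 (ev X w s a) _ _ _ _ _ _ _ _)) => //; try lia.
  + exact: ready_agree ag3 rdy1.
  + by rewrite m3E ?m2E ?m1d //; lia.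
  + by rewrite m3E ?m2d1 ?m1d ?subn0 //; lia.
  + move=> m' [-> h]; split=> //; apply: (agree_trans ag1).
    by apply: (agree_trans ag3 h).
- have leT : cost (weight a) + (cost (weight b) + 1) <= cost (weight a + weight b + 1).
    have /cost_mono := leq_addr (weight b + 1) (weight a).
    have /cost_mono : weight b <= weight a + weight b + 1 by lia.
    rewrite addnA; have := unit_cost_pow (weight a + weight b + 1).
    by rewrite [cost (_ + 1)]costE !mulnDr !mulnDl muln1; lia.
  apply: runs_weak leT (fun m' q => q).
  apply: runs_seq; first by apply: IHa => //; lia.
  move=> m1 [m1d ag1]; have rdy1 := ready_agree d5 ag1 rdy.
  apply: runs_seq.
    apply: (IHb r d.+1 m1 s) => //; try lia.
    by move=> i; have [ri <-] := rP i; split; [lia | rewrite ag1 //; lia].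
  move=> m2 [m2d1 ag2]; apply: runs_add => m3 m3d m3E; split.
    by rewrite m3d m2d1 ag2 ?m1d //; lia.
  apply: (agree_trans ag1); apply: (@agree_trans _ _ _ m2) => //.
    by move=> j hj; rewrite ag2 //; lia.
  by apply: agree_change m3E; lia.
- have leT : cost (weight a) + (cost (weight b) + 1) <= cost (weight a + weight b + 1).
    have /cost_mono := leq_addr (weight b + 1) (weight a).
    have /cost_mono : weight b <= weight a + weight b + 1 by lia.
    rewrite addnA; have := unit_cost_pow (weight a + weight b + 1).
    by rewrite [cost (_ + 1)]costE !mulnDr !mulnDl muln1; lia.
  apply: runs_weak leT (fun m' q => q).
  apply: runs_seq; first by apply: IHa => //; lia.
  move=> m1 [m1d ag1]; have rdy1 := ready_agree d5 ag1 rdy.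
  apply: runs_seq.
    apply: (IHb r d.+1 m1 s) => //; try lia.
    by move=> i; have [ri <-] := rP i; split; [lia | rewrite ag1 //; lia].
  move=> m2 [m2d1 ag2]; apply: runs_sub => m3 m3d m3E; split.
    by rewrite m3d m2d1 ag2 ?m1d //; lia.
  apply: (agree_trans ag1); apply: (@agree_trans _ _ _ m2) => //.
    by move=> j hj; rewrite ag2 //; lia.
  by apply: agree_change m3E; lia.
- set N := weight c + weight a + weight b + 1.
  have leT : cost (weight c) + (cost (weight a) + cost (weight b)).+1 <= cost N.
    have /cost_mono : weight c <= N by lia.
    have /cost_mono : weight a <= N by lia.
    have /cost_mono : weight b <= N by lia.
    have := unit_cost_pow N.
    by rewrite [cost N]costE {2}/N !mulnDr !mulnDl muln1; lia.
  apply: runs_weak leT (fun m' q => q).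
  apply: runs_seq; first by apply: IHc => //; lia.
  move=> m1 [m1d ag1]; have rdy1 := ready_agree d5 ag1 rdy.
  have rP1 i : r i < d /\ m1 (r i) = s i.
    by have [ri <-] := rP i; split; [lia | rewrite ag1 //; lia].
  apply: runs_if => [pos | zero].
    have dKa : d + weight a <= K by lia.
    apply: (runs_weak (IHa r d m1 s d5 dKa rdy1 rP1) (leq_addr _ _)) => m' [-> ag2].
    by rewrite -m1d pos; split=> //; apply: (agree_trans ag1 ag2).
  have dKb : d + weight b <= K by lia.
  apply: (runs_weak (IHb r d m1 s d5 dKb rdy1 rP1) (leq_addl _ _)) => m' [-> ag2].
  by rewrite -m1d zero; split=> //; apply: (agree_trans ag1 ag2).
- set N := weight b + weight e0 + weight f + 4.
  set F := fun i acc => ev X w (scons i (scons acc s)) f.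
  set L := minn (ev X w s b) X.
  have leT : (cost (weight b) + (1 + 1)) + ((cost (weight e0) + 1) +
     ((L * (cost (weight f) + (2 + (1 + (1 + 1)))).+1 + 1) + 2)) <= cost N.
    have /cost_mono : weight b <= N by lia.
    have /cost_mono : weight e0 <= N by lia.
    have h : X.+1 * cost (weight f) <= unit_cost * weight f * X.+1 ^ N.
      rewrite costE mulnCA -expnS; apply: leq_mul => //; apply: leq_pexp2l; lia.
    have h2 : X.+1 <= X.+1 ^ N by rewrite -[leqLHS]expn1 leq_pexp2l //; lia.
    have LX : L <= X by rewrite /L geq_minr.
    have h3 : L * (cost (weight f) + (2 + (1 + (1 + 1)))).+1 <=
      X.+1 * cost (weight f) + 6 * X.+1 ^ N.
      apply: (@leq_trans (X.+1 * (cost (weight f) + 6))).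
        by apply: leq_mul; lia.
      by rewrite mulnDr mulnC; lia.
    have := unit_cost_pow N.
    have -> : cost N = unit_cost * weight b * X.+1 ^ N + unit_cost * weight e0 * X.+1 ^ N
      + unit_cost * weight f * X.+1 ^ N + 4 * (unit_cost * X.+1 ^ N).
      by rewrite costE {1}/N; move: unit_cost (X.+1 ^ N) => u P; lia.
    have : 20 * X.+1 ^ N <= unit_cost * X.+1 ^ N by rewrite leq_mul2r leq_addl orbT.
    lia.
  apply: runs_weak leT (fun m' q => q).
  apply: (@runs_seq _ _ _ _ _ (fun m1 => m1 d = L /\ agree d K m m1)).
    apply: runs_seq; first by apply: IHb => //; lia.
    move=> m1 [m1d ag1]; have [m13 _ _ _] := ready_agree d5 ag1 rdy.
    apply: (@runs_seq _ _ _ _ _ (fun m2 => m2 d.+1 = m1 d - m1 3 /\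
      forall x, x != d.+1 -> m2 x = m1 x)); first exact: runs_sub.
    move=> m2 [m2d1 m2E]; apply: runs_sub => m3 m3d m3E; split.
      by rewrite m3d m2d1 m2E ?m1d ?m13 /L; lia.
    apply: (agree_trans ag1); apply: (@agree_trans _ _ _ m2) => //.
      by apply: agree_change m2E; lia.
    by apply: agree_change m3E; lia.
  move=> m1 [m1d ag1]; have rdy1 := ready_agree d5 ag1 rdy.
  apply: (@runs_seq _ _ _ _ _ (fun m2 => [/\ m2 d = L, m2 d.+1 = 0,
     m2 d.+2 = ev X w s e0 & agree d K m1 m2])).
    apply: runs_seq.
      apply: (IH0 r d.+2 m1 s) => //; try lia.
      by move=> i; have [ri <-] := rP i; split; [lia | rewrite ag1 //; lia].
    move=> m2 [m2d2 ag2]; apply: runs_const => m3 m3d1 m3E; split=> //.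
    + by rewrite m3E ?ag2 //; lia.
    + by rewrite m3E //; lia.
    + apply: (@agree_trans _ _ _ m2) => //; last by apply: agree_change m3E; lia.
      by move=> j hj; apply: ag2; lia.
  move=> m2 [m2d m2d1 m2d2 ag2].
  pose Inv k m' := [/\ m' d = k, k <= L, m' d.+1 = L - k,
    m' d.+2 = iteri (L - k) F (ev X w s e0) & agree d K m m'].
  apply: (@runs_seq _ _ _ _ _ (Inv 0)); last first.
    move=> m3 [_ _ _ m3d2 ag3]; apply: runs_move; first by lia.
    move=> m4 m4d m4E; split; first by rewrite m4d m3d2 subn0.
    by apply: (agree_trans ag3); apply: agree_change m4E; lia.
  have Inv0 : Inv L m2.
    by split=> //; rewrite ?subnn //; apply: (agree_trans ag1 ag2).
  apply: (@runs_while _ _ Inv _ L) => // [k m' []// | k m3 [m3d kL m3d1 m3d2 ag3]].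
  have rdy3 := ready_agree d5 ag3 rdy.
  apply: runs_seq.
    apply: (IHf _ d.+3 m3 (scons (L - k.+1) (scons (iteri (L - k.+1) F (ev X w s e0)) s))) => //.
    + by lia.
    + by lia.
    move=> [|[|i]] /=; [by split => // | by split => // |].
    by have [ri <-] := rP i; split; [lia | rewrite ag3 //; lia].
  move=> m4 [m4d3 ag4].
  apply: (@runs_seq _ _ _ _ _ (fun m5 => m5 d.+2 = m4 d.+3 /\
    forall x, x != d.+2 -> m5 x = m4 x)); first by apply: runs_move => //; lia.
  move=> m5 [m5d2 m5E].
  apply: (@runs_seq _ _ _ _ _ (fun m6 => m6 d.+3 = 1 /\
    forall x, x != d.+3 -> m6 x = m5 x)); first exact: runs_const.
  move=> m6 [m6d3 m6E].
  apply: (@runs_seq _ _ _ _ _ (fun m7 => m7 d.+1 = m6 d.+1 + m6 d.+3 /\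
    forall x, x != d.+1 -> m7 x = m6 x)); first exact: runs_add.
  move=> m7 [m7d1 m7E]; apply: runs_sub => m8 m8d m8E.
  have Lk : L - k = (L - k.+1).+1 by lia.
  split.
  + rewrite m8d (m7E d) ?(m6E d) ?(m5E d) ?ag4 ?(m7E d.+3) ?m6d3; lia.
  + by lia.
  + by rewrite m8E ?m7d1 ?(m6E d.+1) ?(m5E d.+1) ?ag4 ?m6d3 ?m3d1; lia.
  + by rewrite m8E ?m7E ?m6E ?m5d2 ?m4d3 ?Lk //=; lia.
  + move=> j hj; rewrite m8E ?m7E ?m6E ?m5E ?ag4 ?ag3 //; lia.
- have leT : cost (weight a) + (cost (weight b) + 2) <= cost (weight a + weight b + 1).
    have /cost_mono := leq_addr (weight b + 1) (weight a).
    have /cost_mono : weight b <= weight a + weight b + 1 by lia.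
    rewrite addnA; have := unit_cost_pow (weight a + weight b + 1).
    by rewrite [cost (_ + 1)]costE !mulnDr !mulnDl muln1; lia.
  apply: runs_weak leT (fun m' q => q).
  apply: runs_seq; first by apply: IHa => //; lia.
  move=> m1 [m1d ag1]; have rdy1 := ready_agree d5 ag1 rdy.
  apply: runs_seq.
    apply: (IHb _ d.+1 m1 (scons (ev X w s a) s)) => //; try lia.
    move=> [|i] /=; first by split.
    by have [ri <-] := rP i; split; [lia | rewrite ag1 //; lia].
  move=> m2 [m2d1 ag2]; apply: runs_move; first by lia.
  move=> m3 m3d m3E; split; first by rewrite m3d m2d1.
  apply: (agree_trans ag1); apply: (@agree_trans _ _ _ m2) => //.
    by move=> j hj; rewrite ag2 //; lia.
  by apply: agree_change m3E; lia.
- by apply: IHa => // i; apply: rP.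
Qed.

End Compile.

(* Cells 3 to [K - 1] serve as registers; the input bits found there are first
   recorded in the control flow, by branching on each of them. *)
Fixpoint stash (body : seq nat -> cmd) (i fuel : nat) (bits : seq nat) : cmd :=
  if fuel is f.+1 then
    CIf i (stash body i.+1 f (rcons bits 1)) (stash body i.+1 f (rcons bits 0))
  else body bits.

Lemma stash_ok body w T Q j f :
  (forall i, 3 <= i -> w i <= 1) ->
  runs (body (mkseq (fun i => w (3 + i)) (j + f))) w T Q ->
  runs (stash body (3 + j) f (mkseq (fun i => w (3 + i)) j)) w (f + T) Q.
Proof.
move=> w01; elim: f j => [|f IHf] j; first by rewrite addn0.
rewrite -addSnnS => /IHf {IHf} /=.
have -> : mkseq (fun i => w (3 + i)) j.+1 = rcons (mkseq (fun i => w (3 + i)) j) (w (3 + j)).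
  by rewrite /mkseq -[j.+1]addn1 iotaD map_cat cats1.
have w1 : w (3 + j) <= 1 by apply: w01.
move=> h; apply: runs_if => wj; move: h.
  by have -> : w (3 + j) = 1 by lia.
by rewrite wj.
Qed.

Lemma stage_ok K X w bits e m :
  (forall i, 3 <= i < K -> nth 0 bits (i - 3) = w i) ->
  5 + weight e <= K -> ready K X w m ->
  runs (CSeq (compile K bits (fun=> 4) 5 e) (move 3 5)) m
    ((2 * K + 20) * weight e * X.+1 ^ weight e + 2) (ready K (ev X w (fun=> 0) e) w).
Proof.
move=> bitsP eK rdy; have [_ m4 _ _] := rdy.
apply: runs_seq; first by apply: (compile_ok bitsP _ eK rdy (s := fun=> 0)).
move=> m1 [m15 ag]; apply: runs_move => // m2 m23 m2E.
have [_ m14 m1lo m1hi] : ready K X w m1 by apply: ready_agree ag rdy.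
split; first by rewrite m23.
- by rewrite m2E.
- by move=> i i3; rewrite m2E ?m1lo //; lia.
- by move=> i Ki; rewrite m2E ?m1hi //; lia.
Qed.

Definition staged (K : nat) (e1 e2 e3 : expr) (bits : seq nat) : cmd :=
  let stage e := CSeq (compile K bits (fun=> 4) 5 e) (move 3 5) in
  CSeq (CConst 4 0) (CSeq (move 3 0)
    (CSeq (stage e1) (CSeq (stage e2) (CSeq (stage e3) (move 0 3))))).

Lemma staged_program (e1 e2 e3 : expr) :
  exists (p : cmd) (c : nat), forall w : memory, (forall i, 3 <= i -> w i <= 1) ->
    let X1 := ev (w 0) w (fun=> 0) e1 in
    let X2 := ev X1 w (fun=> 0) e2 in
    runs p w (c * (w 0 + X1 + X2).+1 ^ c) (fun m => m 0 = ev X2 w (fun=> 0) e3).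
Proof.
pose W := weight e1 + weight e2 + weight e3; pose K := 5 + W.
exists (stash (staged K e1 e2 e3) 3 (K - 3) [::]), (3 * ((2 * K + 20) * W) + K + 20).
move=> w w01 X1 X2; set c := 3 * _ + K + 20; set Z := (w 0 + X1 + X2).+1.
have costle e X : weight e <= W -> X < Z ->
    (2 * K + 20) * weight e * X.+1 ^ weight e <= (2 * K + 20) * W * Z ^ c.
  move=> eW XZ; apply: leq_mul; first by rewrite leq_mul2l eW orbT.
  apply: (@leq_trans (Z ^ weight e)); last by apply: leq_pexp2l => //; rewrite /c /K; nia.
  by case: (weight e) => // h; rewrite leq_exp2r.
have Z1 : 1 <= Z ^ c by rewrite expn_gt0.
pose c0 x := (2 * K + 20) * weight x.
have leT : (K - 3) + (1 + (2 + ((c0 e1 * (w 0).+1 ^ weight e1 + 2) +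
    ((c0 e2 * X1.+1 ^ weight e2 + 2) + ((c0 e3 * X2.+1 ^ weight e3 + 2) + 2)))))
    <= c * Z ^ c.
  have := costle e1 (w 0); have := costle e2 X1; have := costle e3 X2.
  rewrite -!/(c0 _); have -> : c * Z ^ c =
    3 * ((2 * K + 20) * W * Z ^ c) + (K + 20) * Z ^ c.
    by move: (Z ^ c) => P; rewrite /c; lia.
  have : K + 20 <= (K + 20) * Z ^ c by rewrite leq_pmulr.
  move: (_ * _ * Z ^ c) (_ * Z ^ c) => A B.
  have -> : weight e1 <= W by rewrite /W; lia.
  have -> : weight e2 <= W by rewrite /W; lia.
  have -> : weight e3 <= W by rewrite /W; lia.
  have -> : w 0 < Z by rewrite /Z; lia.
  have -> : X1 < Z by rewrite /Z; lia.
  have -> : X2 < Z by rewrite /Z; lia.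
  move: (c0 _ * _) (c0 _ * _) (c0 _ * _) => C1 C2 C3 h0 h1 h2 h3.
  have {}h1 := h1 isT isT; have {}h2 := h2 isT isT; have {}h3 := h3 isT isT.
  lia.
apply: runs_weak leT (fun m q => q).
apply: (@stash_ok _ w _ _ 0) => //; rewrite add0n /staged.
set bits := mkseq _ _.
have bitsP i : 3 <= i < K -> nth 0 bits (i - 3) = w i.
  by move=> h; rewrite nth_mkseq ?subnKC //; lia.
apply: (@runs_seq _ _ _ _ _ (fun m => m 4 = 0 /\ forall x, x != 4 -> m x = w x)).
  exact: runs_const.
move=> m [m4 mE].
apply: (@runs_seq _ _ _ _ _ (ready K (w 0) w)).
  apply: runs_move => // m1 m13 m1E; split.
  - by rewrite m13 mE.
  - by rewrite m1E.
  - by move=> i i3; rewrite m1E ?mE //; lia.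
  - by move=> i Ki; rewrite m1E ?mE //; rewrite /K in Ki; lia.
move=> m1 rdy1; apply: runs_seq; first by apply: stage_ok rdy1; rewrite // /K /W; lia.
move=> m2 rdy2; apply: runs_seq; first by apply: stage_ok rdy2; rewrite // /K /W; lia.
move=> m3 rdy3; apply: runs_seq; first by apply: stage_ok rdy3; rewrite // /K /W; lia.
by move=> m4' [m43 _ _ _]; apply: runs_move => // m5 ->.
Qed.

(** * The algorithm *)

Definition computable (f : nat -> memory -> (nat -> nat) -> nat) : Prop :=
  exists e, forall X w s, ev X w s e = f X w s.

Definition sumb (X b : nat) (f : nat -> nat) : nat := \sum_(0 <= i < minn b X) f i.
Definition maxb (X b : nat) (f : nat -> nat) : nat := \max_(0 <= i < minn b X) f i.
Definition hasb (X b : nat) (p : pred nat) : bool := has p (iota 0 (minn b X)).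
Definition allb (X b : nat) (p : pred nat) : bool := all p (iota 0 (minn b X)).
Definition iterb (X b : nat) (f : nat -> nat -> nat) (x : nat) : nat :=
  iteri (minn b X) f x.

Lemma computable_bound : computable (fun X _ _ => X).
Proof. by exists EX. Qed.

Lemma computable_var i : computable (fun _ _ s => s i).
Proof. by exists (EVar i). Qed.

Lemma computable_const c : computable (fun _ _ _ => c).
Proof. by exists (ECst c). Qed.

Lemma computable_input f : computable f -> computable (fun X w s => w (f X w s)).
Proof. by move=> [e he]; exists (EIn e) => X w s; rewrite /= he. Qed.

Section Closure.

Variables (f g : nat -> memory -> (nat -> nat) -> nat).
Variables (p q : nat -> memory -> (nat -> nat) -> bool).
Hypotheses (cf : computable f) (cg : computable g).
Hypotheses (cp : computable (fun X w s => p X w s)) (cq : computable (fun X w s => q X w s)).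

Lemma computable_add : computable (fun X w s => f X w s + g X w s).
Proof. by case: cf cg => [a ha] [b hb]; exists (EAdd a b) => X w s; rewrite /= ha hb. Qed.

Lemma computable_sub : computable (fun X w s => f X w s - g X w s).
Proof. by case: cf cg => [a ha] [b hb]; exists (ESub a b) => X w s; rewrite /= ha hb. Qed.

Lemma computable_succ : computable (fun X w s => (f X w s).+1).
Proof. by case: cf => [a ha]; exists (EAdd (ECst 1) a) => X w s; rewrite /= ha. Qed.

Lemma computable_leq : computable (fun X w s => f X w s <= g X w s).
Proof.
case: cf cg => [a ha] [b hb]; exists (EIf (ESub a b) (ECst 0) (ECst 1)) => X w s /=.
by rewrite ha hb subn_gt0 ltnNge; case: leq.
Qed.

Lemma computable_eq : computable (fun X w s => f X w s == g X w s).
Proof.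
case: cf cg => [a ha] [b hb].
exists (EIf (EAdd (ESub a b) (ESub b a)) (ECst 0) (ECst 1)) => X w s /=.
rewrite ha hb; case: eqP => [->|]; first by rewrite subnn.
by case: ltnP => //; lia.
Qed.

Lemma computable_if : computable (fun X w s => if p X w s then f X w s else g X w s).
Proof.
case: cp cf cg => [c hc] [a ha] [b hb]; exists (EIf c a b) => X w s /=.
by rewrite ha hb hc; case: (p X w s).
Qed.

Lemma computable_and : computable (fun X w s => p X w s && q X w s).
Proof.
case: cp cq => [a ha] [b hb]; exists (EIf a b (ECst 0)) => X w s /=.
by rewrite ha hb; case: (p X w s).
Qed.

Lemma computable_or : computable (fun X w s => p X w s || q X w s).
Proof.
case: cp cq => [a ha] [b hb]; exists (EIf a (ECst 1) b) => X w s /=.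
by rewrite ha hb; case: (p X w s).
Qed.

Lemma computable_imp : computable (fun X w s => p X w s ==> q X w s).
Proof.
case: cp cq => [a ha] [b hb]; exists (EIf a b (ECst 1)) => X w s /=.
by rewrite ha hb; case: (p X w s).
Qed.

Lemma computable_not : computable (fun X w s => ~~ p X w s).
Proof.
case: cp => [a ha]; exists (ESub (ECst 1) a) => X w s /=.
by rewrite ha; case: (p X w s).
Qed.

End Closure.

Lemma computable_eqb p q :
  computable (fun X w s => nat_of_bool (p X w s)) ->
  computable (fun X w s => nat_of_bool (q X w s)) ->
  computable (fun X w s => nat_of_bool (p X w s == q X w s)).
Proof.
move=> cp cq; have [a ha] := computable_eq cp cq; exists a => X w s.
by rewrite ha; case: (p X w s); case: (q X w s).
Qed.

Lemma computable_iterb b (f : nat -> memory -> nat -> nat -> (nat -> nat) -> nat) x :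
  computable b -> computable (fun X w s => f X w (s 0) (s 1) (fun j => s j.+2)) ->
  computable x ->
  computable (fun X w s => iterb X (b X w s) (fun i acc => f X w i acc s) (x X w s)).
Proof.
move=> [eb hb] [ef hf] [ex hx]; exists (EIter eb ex ef) => X w s /=.
by rewrite hb hx; apply: eq_iteri => i a; rewrite hf.
Qed.

Lemma computable_sumb b (f : nat -> memory -> nat -> (nat -> nat) -> nat) :
  computable b -> computable (fun X w s => f X w (s 0) (fun j => s j.+1)) ->
  computable (fun X w s => sumb X (b X w s) (fun i => f X w i s)).
Proof.
move=> [eb hb] [ef hf].
exists (EIter eb (ECst 0) (EAdd (EVar 1) (ERen (fun i => if i is j.+1 then j.+2 else 0) ef))).
move=> X w s /=; rewrite hb /sumb; elim: (minn _ _) => [|n IHn]; first by rewrite big_nil.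
by rewrite big_nat_recr //= IHn hf.
Qed.

Lemma computable_maxb b (f : nat -> memory -> nat -> (nat -> nat) -> nat) :
  computable b -> computable (fun X w s => f X w (s 0) (fun j => s j.+1)) ->
  computable (fun X w s => maxb X (b X w s) (fun i => f X w i s)).
Proof.
move=> [eb hb] [ef hf].
exists (EIter eb (ECst 0)
  (EAdd (EVar 1) (ESub (ERen (fun i => if i is j.+1 then j.+2 else 0) ef) (EVar 1)))).
move=> X w s /=; rewrite hb /maxb; elim: (minn _ _) => [|n IHn]; first by rewrite big_nil.
by rewrite big_nat_recr //= IHn hf -maxnE.
Qed.

Lemma computable_hasb b (p : nat -> memory -> nat -> (nat -> nat) -> bool) :
  computable b -> computable (fun X w s => nat_of_bool (p X w (s 0) (fun j => s j.+1))) ->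
  computable (fun X w s => nat_of_bool (hasb X (b X w s) (fun i => p X w i s))).
Proof.
move=> cb cp.
have [e he] := computable_leq (computable_const 1)
  (computable_sumb (f := fun X w i s => nat_of_bool (p X w i s)) cb cp).
exists e => X w s; rewrite he /sumb /hasb; congr nat_of_bool.
elim: (minn _ _) => [|n IHn]; first by rewrite big_nil.
have -> : iota 0 n.+1 = rcons (iota 0 n) n by rewrite -addn1 iotaD cats1.
by rewrite has_rcons big_nat_recr //= addn_gt0 IHn orbC; case: (p X w n s).
Qed.

Lemma computable_allb b (p : nat -> memory -> nat -> (nat -> nat) -> bool) :
  computable b -> computable (fun X w s => nat_of_bool (p X w (s 0) (fun j => s j.+1))) ->
  computable (fun X w s => nat_of_bool (allb X (b X w s) (fun i => p X w i s))).
Proof.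
move=> cb cp; have [e he] := computable_not (computable_hasb
  (p := fun X w i s => ~~ p X w i s) cb (computable_not cp)).
by exists e => X w s; rewrite he /hasb has_predC negbK.
Qed.

Lemma computable_call1 (h : nat -> memory -> nat -> nat) f :
  computable (fun X w s => h X w (s 0)) -> computable f ->
  computable (fun X w s => h X w (f X w s)).
Proof. by move=> [eh hh] [ef hf]; exists (ELet ef eh) => X w s /=; rewrite hh /= hf. Qed.

Lemma computable_call2 (h : nat -> memory -> nat -> nat -> nat) f g :
  computable (fun X w s => h X w (s 0) (s 1)) -> computable f -> computable g ->
  computable (fun X w s => h X w (f X w s) (g X w s)).
Proof.
move=> [eh hh] [ef hf] [eg hg].
exists (ELet ef (ELet (ERen S eg) (ERen (fun i => 1 - i) eh))) => X w s /=.
by rewrite hh /= hg hf.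
Qed.

Lemma computable_call3 (h : nat -> memory -> nat -> nat -> nat -> nat) f g k :
  computable (fun X w s => h X w (s 0) (s 1) (s 2)) ->
  computable f -> computable g -> computable k ->
  computable (fun X w s => h X w (f X w s) (g X w s) (k X w s)).
Proof.
move=> [eh hh] [ef hf] [eg hg] [ek hk].
exists (ELet ef (ELet (ERen S eg) (ELet (ERen (addn 2) ek) (ERen (fun i => 2 - i) eh)))).
by move=> X w s /=; rewrite hh /= hk hg hf.
Qed.

(* The bounded operators agree with the exact ones only when the loop bound [X]
   is large enough. *)
Definition mul X a b := iterb X a (fun _ acc => acc + b) 0.
Definition divb X a b := sumb X X (fun t => nat_of_bool (mul X t.+1 b <= a)).
Definition modb X a b := a - mul X (divb X a b) b.
Definition powb X b i := iterb X i (fun _ acc => mul X b acc) 1.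
Definition dig X b i a := modb X (divb X a (powb X b i)) b.
Definition double4 a := (a + a + (a + a)) + (a + a + (a + a)) +
  ((a + a + (a + a)) + (a + a + (a + a))).
Definition pow2 X i := iterb X i (fun _ acc => acc + acc) 1.

Definition in_mod (w : memory) v : bool := 0 < w (3 + v).
Definition adj X (w : memory) u v : bool := 0 < w (3 + w 0 + mul X u (w 0) + v).
Definition mod_size X w := sumb X (w 0) (fun v => nat_of_bool (in_mod w v)).
Definition cadj X w u v : bool := (u == v) || adj X w u v.
Definition twin X w u v : bool := allb X (w 0) (fun x => cadj X w u x == cadj X w v x).
Definition item X w u : bool :=
  in_mod w u || ~~ hasb X u (fun v => ~~ in_mod w v && twin X w v u).
Definition is_rep X w s u : bool :=
  item X w s && ((s == u) || (~~ in_mod w s && ~~ in_mod w u && twin X w s u)).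
Definition item_rank X w u := sumb X u (fun v => nat_of_bool (item X w v)).
Definition mod_rank X w u := sumb X u (fun v => nat_of_bool (in_mod w v)).
Definition root_b X w r : bool :=
  ~~ in_mod w r && ~~ hasb X r (fun u => ~~ in_mod w u && adj X w u r).
Definition in_clique X w r u : bool := ~~ in_mod w u && cadj X w r u.

Definition class_b X w g c s : bool :=
  item X w s && (0 < dig X 2 (mul X c (item_rank X w (w 0)) + item_rank X w s) g).
Definition valid_b X w g : bool :=
  [&& allb X (w 0) (fun v => in_mod w v ==>
        hasb X (mod_size X w) (fun c => class_b X w g c v)),
      allb X (mod_size X w) (fun c => allb X (w 0) (fun s => allb X (w 0) (fun t =>
        (class_b X w g c s && class_b X w g c t) ==> ~~ adj X w s t))),
      allb X (mod_size X w) (fun c => hasb X (w 0) (fun v => allb X (w 0) (fun s =>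
        class_b X w g c s ==> cadj X w v s))) &
      allb X (w 0) (fun s =>
        sumb X (mod_size X w) (fun c => nat_of_bool (class_b X w g c s)) <=
        sumb X (w 0) (fun u => nat_of_bool (is_rep X w s u)))].
Definition used_b X w g :=
  sumb X (mod_size X w) (fun c => nat_of_bool (hasb X (w 0) (fun s => class_b X w g c s))).

Definition subset_b X w a v : bool := in_mod w v && (0 < dig X 2 (mod_rank X w v) a).
Definition nbh_sub_b X w a u : bool :=
  allb X (w 0) (fun v => (in_mod w v && adj X w u v) ==> subset_b X w a v).
Definition rest_b X w g r a :=
  sumb X (w 0) (fun u => nat_of_bool (in_clique X w r u && nbh_sub_b X w a u)) -
  sumb X (mod_size X w) (fun c => sumb X (w 0) (fun s =>
    nat_of_bool (class_b X w g c s && (in_clique X w r s && nbh_sub_b X w a s)))).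

(* [Y] codes [y] in base [n + 1]; the leading digits are stripped one at a time
   because [modb] and [divb] need a quotient of at most [X]. *)
Definition ydig X (w : memory) Y v :=
  divb X (iterb X (w 0 - v.+1)
            (fun i r => modb X r (powb X (w 0).+1 (w 0 - i.+1))) Y)
         (powb X (w 0).+1 v).
Definition value_b X w g Y :=
  sumb X (w 0) (fun v => if in_mod w v then ydig X w Y v else 0) +
  sumb X (w 0) (fun r => if root_b X w r then maxb X X (fun a =>
    rest_b X w g r a - sumb X (w 0) (fun v =>
      if subset_b X w a v then ydig X w Y v else 0)) else 0).

Definition digit_bits X w := double4 (pow2 X (mod_size X w)).
(* The digits of [x] are displacements shifted by half the base, to allow
   negative ones. *)
Definition shift_b X w Y x v :=
  ydig X w Y v + dig X (pow2 X (digit_bits X w)) (mod_rank X w v) x -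
  pow2 X (digit_bits X w - 1).
Definition clip_b X w Y x v :=
  if in_mod w v then
    if shift_b X w Y x v <= w 0 then shift_b X w Y x v else w 0
  else 0.
Definition cand_b X w Y x :=
  sumb X (w 0) (fun v => mul X (clip_b X w Y x v) (powb X (w 0).+1 v)).
Definition try_b X w g x Y :=
  if value_b X w g (cand_b X w Y x) < value_b X w g Y then cand_b X w Y x else Y.
Definition round_b X w g Y := iterb X X (fun x Z => try_b X w g x Z) Y.
Definition search_b X w g := iterb X X (fun _ Y => round_b X w g Y) 0.

Definition answer X (w : memory) : bool :=
  (w 1 == 0) && hasb X X (fun g =>
    valid_b X w g && (used_b X w g + value_b X w g (search_b X w g) <= w 2)).

(* The loop bounds of the second and third stages; the first stage has bound [n]. *)
Definition bound1 X w := w 0 + digit_bits X w.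
Definition bound2 X w :=
  iterb X (mod_size X w) (fun _ a =>
    iterb X (digit_bits X w) (fun _ b => b + b)
      (iterb X (item_rank X w (w 0)) (fun _ b => b + b) a)) (w 0 + 20).

Ltac computable_step :=
  lazymatch goal with
  | |- computable (fun X w s => s _) => apply: computable_var
  | |- computable (fun X w s => X) => exact: computable_bound
  | |- computable (fun X w s => w _) => apply: computable_input
  | |- computable (fun X w s => _ + _) => apply: computable_add
  | |- computable (fun X w s => _ - _) => apply: computable_sub
  | |- computable (fun X w s => (_).+1) => apply: computable_succ
  | |- computable (fun X w s => nat_of_bool (_ <= _)) => apply: computable_leq
  | |- computable (fun X w s => nat_of_bool (_ == _)) =>
      first [apply: computable_eq | apply: computable_eqb]
  | |- computable (fun X w s => nat_of_bool (_ && _)) => apply: computable_and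
  | |- computable (fun X w s => nat_of_bool (_ || _)) => apply: computable_or
  | |- computable (fun X w s => nat_of_bool (_ ==> _)) => apply: computable_imp
  | |- computable (fun X w s => nat_of_bool (~~ _)) => apply: computable_not
  | |- computable (fun X w s => if _ then _ else _) => apply: computable_if
  | |- computable (fun X w s => iterb _ _ _ _) => apply: computable_iterb
  | |- computable (fun X w s => sumb _ _ _) => apply: computable_sumb
  | |- computable (fun X w s => maxb _ _ _) => apply: computable_maxb
  | |- computable (fun X w s => nat_of_bool (hasb _ _ _)) => apply: computable_hasb
  | |- computable (fun X w s => nat_of_bool (allb _ _ _)) => apply: computable_allb
  | |- computable (fun X w s => ?c) => exact: (computable_const c)
  end; cbn beta.

Create HintDb computable discriminated.
#[local] Hint Constants Opaque : computable.
#[local] Hint Extern 5 (computable _) => computable_step : computable.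

Lemma computable_mul f g :
  computable f -> computable g ->
  computable (fun X w s => mul X (f X w s) (g X w s)).
Proof.
apply: (computable_call2 (h := fun X w a b => mul X a b)).
by rewrite /mul; auto 60 with computable.
Qed.
#[local] Hint Resolve computable_mul : computable.

Lemma computable_divb f g :
  computable f -> computable g ->
  computable (fun X w s => divb X (f X w s) (g X w s)).
Proof.
apply: (computable_call2 (h := fun X w a b => divb X a b)).
by rewrite /divb; auto 60 with computable.
Qed.
#[local] Hint Resolve computable_divb : computable.

Lemma computable_modb f g :
  computable f -> computable g ->
  computable (fun X w s => modb X (f X w s) (g X w s)).
Proof.
apply: (computable_call2 (h := fun X w a b => modb X a b)).
by rewrite /modb; auto 60 with computable.
Qed.
#[local] Hint Resolve computable_modb : computable.

Lemma computable_powb f g :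
  computable f -> computable g ->
  computable (fun X w s => powb X (f X w s) (g X w s)).
Proof.
apply: (computable_call2 (h := fun X w a b => powb X a b)).
by rewrite /powb; auto 60 with computable.
Qed.
#[local] Hint Resolve computable_powb : computable.

Lemma computable_dig f g h :
  computable f -> computable g -> computable h ->
  computable (fun X w s => dig X (f X w s) (g X w s) (h X w s)).
Proof.
apply: (computable_call3 (h := fun X w a b c => dig X a b c)).
by rewrite /dig; auto 60 with computable.
Qed.
#[local] Hint Resolve computable_dig : computable.

Lemma computable_pow2 f :
  computable f ->
  computable (fun X w s => pow2 X (f X w s)).
Proof.
apply: (computable_call1 (h := fun X w a => pow2 X a)).
by rewrite /pow2; auto 60 with computable.
Qed.
#[local] Hint Resolve computable_pow2 : computable.

Lemma computable_in_mod f : computable f ->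
  computable (fun X w s => nat_of_bool (in_mod w (f X w s))).
Proof. by move=> cf; rewrite /in_mod; auto 60 with computable. Qed.
#[local] Hint Resolve computable_in_mod : computable.

Lemma computable_adj f g :
  computable f -> computable g ->
  computable (fun X w s => nat_of_bool (adj X w (f X w s) (g X w s))).
Proof.
apply: (computable_call2 (h := fun X w a b => nat_of_bool (adj X w a b))).
by rewrite /adj; auto 60 with computable.
Qed.
#[local] Hint Resolve computable_adj : computable.

Lemma computable_mod_size :
  computable (fun X w s => mod_size X w).
Proof. by rewrite /mod_size; auto 60 with computable. Qed.
#[local] Hint Resolve computable_mod_size : computable.

Lemma computable_cadj f g :
  computable f -> computable g ->
  computable (fun X w s => nat_of_bool (cadj X w (f X w s) (g X w s))).
Proof.
apply: (computable_call2 (h := fun X w a b => nat_of_bool (cadj X w a b))).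
by rewrite /cadj; auto 60 with computable.
Qed.
#[local] Hint Resolve computable_cadj : computable.

Lemma computable_twin f g :
  computable f -> computable g ->
  computable (fun X w s => nat_of_bool (twin X w (f X w s) (g X w s))).
Proof.
apply: (computable_call2 (h := fun X w a b => nat_of_bool (twin X w a b))).
by rewrite /twin; auto 60 with computable.
Qed.
#[local] Hint Resolve computable_twin : computable.

Lemma computable_item f :
  computable f ->
  computable (fun X w s => nat_of_bool (item X w (f X w s))).
Proof.
apply: (computable_call1 (h := fun X w a => nat_of_bool (item X w a))).
by rewrite /item; auto 60 with computable.
Qed.
#[local] Hint Resolve computable_item : computable.

Lemma computable_is_rep f g :
  computable f -> computable g ->
  computable (fun X w s => nat_of_bool (is_rep X w (f X w s) (g X w s))).
Proof.
apply: (computable_call2 (h := fun X w a b => nat_of_bool (is_rep X w a b))).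
by rewrite /is_rep; auto 60 with computable.
Qed.
#[local] Hint Resolve computable_is_rep : computable.

Lemma computable_item_rank f :
  computable f ->
  computable (fun X w s => item_rank X w (f X w s)).
Proof.
apply: (computable_call1 (h := fun X w a => item_rank X w a)).
by rewrite /item_rank; auto 60 with computable.
Qed.
#[local] Hint Resolve computable_item_rank : computable.

Lemma computable_mod_rank f :
  computable f ->
  computable (fun X w s => mod_rank X w (f X w s)).
Proof.
apply: (computable_call1 (h := fun X w a => mod_rank X w a)).
by rewrite /mod_rank; auto 60 with computable.
Qed.
#[local] Hint Resolve computable_mod_rank : computable.

Lemma computable_root_b f :
  computable f ->
  computable (fun X w s => nat_of_bool (root_b X w (f X w s))).
Proof.
apply: (computable_call1 (h := fun X w a => nat_of_bool (root_b X w a))).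
by rewrite /root_b; auto 60 with computable.
Qed.
#[local] Hint Resolve computable_root_b : computable.

Lemma computable_in_clique f g :
  computable f -> computable g ->
  computable (fun X w s => nat_of_bool (in_clique X w (f X w s) (g X w s))).
Proof.
apply: (computable_call2 (h := fun X w a b => nat_of_bool (in_clique X w a b))).
by rewrite /in_clique; auto 60 with computable.
Qed.
#[local] Hint Resolve computable_in_clique : computable.

Lemma computable_class_b f g h :
  computable f -> computable g -> computable h ->
  computable (fun X w s => nat_of_bool (class_b X w (f X w s) (g X w s) (h X w s))).
Proof.
apply: (computable_call3 (h := fun X w a b c => nat_of_bool (class_b X w a b c))).
by rewrite /class_b; auto 60 with computable.
Qed.
#[local] Hint Resolve computable_class_b : computable.

Lemma computable_valid_b f :
  computable f ->
  computable (fun X w s => nat_of_bool (valid_b X w (f X w s))).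
Proof.
apply: (computable_call1 (h := fun X w a => nat_of_bool (valid_b X w a))).
by rewrite /valid_b; auto 60 with computable.
Qed.
#[local] Hint Resolve computable_valid_b : computable.

Lemma computable_used_b f :
  computable f ->
  computable (fun X w s => used_b X w (f X w s)).
Proof.
apply: (computable_call1 (h := fun X w a => used_b X w a)).
by rewrite /used_b; auto 60 with computable.
Qed.
#[local] Hint Resolve computable_used_b : computable.

Lemma computable_subset_b f g :
  computable f -> computable g ->
  computable (fun X w s => nat_of_bool (subset_b X w (f X w s) (g X w s))).
Proof.
apply: (computable_call2 (h := fun X w a b => nat_of_bool (subset_b X w a b))).
by rewrite /subset_b; auto 60 with computable.
Qed.
#[local] Hint Resolve computable_subset_b : computable.

Lemma computable_nbh_sub_b f g :
  computable f -> computable g ->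
  computable (fun X w s => nat_of_bool (nbh_sub_b X w (f X w s) (g X w s))).
Proof.
apply: (computable_call2 (h := fun X w a b => nat_of_bool (nbh_sub_b X w a b))).
by rewrite /nbh_sub_b; auto 60 with computable.
Qed.
#[local] Hint Resolve computable_nbh_sub_b : computable.

Lemma computable_rest_b f g h :
  computable f -> computable g -> computable h ->
  computable (fun X w s => rest_b X w (f X w s) (g X w s) (h X w s)).
Proof.
apply: (computable_call3 (h := fun X w a b c => rest_b X w a b c)).
by rewrite /rest_b; auto 60 with computable.
Qed.
#[local] Hint Resolve computable_rest_b : computable.

Lemma computable_ydig f g :
  computable f -> computable g ->
  computable (fun X w s => ydig X w (f X w s) (g X w s)).
Proof.
apply: (computable_call2 (h := fun X w a b => ydig X w a b)).
by rewrite /ydig; auto 60 with computable.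
Qed.
#[local] Hint Resolve computable_ydig : computable.

Lemma computable_value_b f g :
  computable f -> computable g ->
  computable (fun X w s => value_b X w (f X w s) (g X w s)).
Proof.
apply: (computable_call2 (h := fun X w a b => value_b X w a b)).
by rewrite /value_b; auto 60 with computable.
Qed.
#[local] Hint Resolve computable_value_b : computable.

Lemma computable_double4 f : computable f -> computable (fun X w s => double4 (f X w s)).
Proof. by move=> cf; rewrite /double4; auto 60 with computable. Qed.
#[local] Hint Resolve computable_double4 : computable.

Lemma computable_digit_bits :
  computable (fun X w s => digit_bits X w).
Proof. by rewrite /digit_bits; auto 60 with computable. Qed.
#[local] Hint Resolve computable_digit_bits : computable.

Lemma computable_shift_b f g h :
  computable f -> computable g -> computable h ->
  computable (fun X w s => shift_b X w (f X w s) (g X w s) (h X w s)).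
Proof.
apply: (computable_call3 (h := fun X w a b c => shift_b X w a b c)).
by rewrite /shift_b; auto 60 with computable.
Qed.
#[local] Hint Resolve computable_shift_b : computable.

Lemma computable_clip_b f g h :
  computable f -> computable g -> computable h ->
  computable (fun X w s => clip_b X w (f X w s) (g X w s) (h X w s)).
Proof.
apply: (computable_call3 (h := fun X w a b c => clip_b X w a b c)).
by rewrite /clip_b; auto 60 with computable.
Qed.
#[local] Hint Resolve computable_clip_b : computable.

Lemma computable_cand_b f g :
  computable f -> computable g ->
  computable (fun X w s => cand_b X w (f X w s) (g X w s)).
Proof.
apply: (computable_call2 (h := fun X w a b => cand_b X w a b)).
by rewrite /cand_b; auto 60 with computable.
Qed.
#[local] Hint Resolve computable_cand_b : computable.

Lemma computable_try_b f g h :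
  computable f -> computable g -> computable h ->
  computable (fun X w s => try_b X w (f X w s) (g X w s) (h X w s)).
Proof.
apply: (computable_call3 (h := fun X w a b c => try_b X w a b c)).
by rewrite /try_b; auto 60 with computable.
Qed.
#[local] Hint Resolve computable_try_b : computable.

Lemma computable_round_b f g :
  computable f -> computable g ->
  computable (fun X w s => round_b X w (f X w s) (g X w s)).
Proof.
apply: (computable_call2 (h := fun X w a b => round_b X w a b)).
by rewrite /round_b; auto 60 with computable.
Qed.
#[local] Hint Resolve computable_round_b : computable.

Lemma computable_search_b f :
  computable f ->
  computable (fun X w s => search_b X w (f X w s)).
Proof.
apply: (computable_call1 (h := fun X w a => search_b X w a)).
by rewrite /search_b; auto 60 with computable.
Qed.
#[local] Hint Resolve computable_search_b : computable.

Lemma computable_answer :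
  computable (fun X w s => nat_of_bool (answer X w )).
Proof. by rewrite /answer; auto 60 with computable. Qed.

Lemma computable_bound1 :
  computable (fun X w s => bound1 X w).
Proof. by rewrite /bound1; auto 60 with computable. Qed.

Lemma computable_bound2 :
  computable (fun X w s => bound2 X w).
Proof. by rewrite /bound2; auto 60 with computable. Qed.

(** * Sign-compatible decompositions and local search *)

Definition dot (T : finType) (V : {set T}) (b x : T -> int) : int :=
  (\sum_(u in V) b u * x u)%R.

Fixpoint dbound (j A t mu : nat) : nat :=
  if j is i.+1 then
    let t' := 2 * t + 2 * (j * (A * mu)) in
    j * (A * dbound i (2 * (A * A)) (A * (t + t')) (A * mu)) + t'
  else 0.

Lemma dot_abs_le (T : finType) (V : {set T}) (b x : T -> int) (A C : nat) :
  (forall u, u \in V -> `|b u|%N <= A) -> (forall u, u \in V -> `|x u|%N <= C) ->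
  `|dot V b x|%N <= #|V| * (A * C).
Proof.
move=> hb hx; rewrite /dot -sum_nat_const.
have : {in V, forall u, `|(b u * x u)%R|%N <= A * C}.
  by move=> u uV; rewrite abszM leq_mul ?hb ?hx.
move: (b) (x) => b' x' h.
elim/big_ind2: _ => [//|m1 n1 m2 n2 h1 h2|u uV]; last exact: h.
by apply: leq_trans (leq_add h1 h2); lia.
Qed.

Lemma dot_setD1 (T : finType) (V : {set T}) (v : T) (b x : T -> int) : v \in V ->
  dot V b x = (b v * x v + dot (V :\ v) b x)%R.
Proof. by move=> vV; rewrite /dot (big_setD1 v). Qed.

Lemma dot_unit (T : finType) (V : {set T}) (v : T) (x : T -> int) : v \in V ->
  dot V (fun u => nat_of_bool (u == v)) x = x v.
Proof.
move=> vV; rewrite (dot_setD1 _ _ vV) eqxx mul1r /dot big1 ?addr0 // => u.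
by rewrite in_setD1 => /andP[/negPf -> _]; rewrite mul0r.
Qed.

(* Each step either halves [D] coordinatewise, when every form takes a large
   value on [D], or eliminates one variable with a form of small value. *)
Lemma sign_compatible_summand (T : finType) (V : {set T}) (A t m mu : nat) (D : T -> int) :
  0 < A -> 0 < m <= mu ->
  (exists2 u, u \in V & dbound #|V| A t mu < `|D u|%N) ->
  exists c : T -> int, let z := fun u => (m%:Z * c u)%R in
    (exists2 u, u \in V & z u <> 0%R) /\
    forall b : T -> int, (forall u, u \in V -> `|b u|%N <= A) ->
      [\/ dot V b z = 0%R,
          (t%:Z < dot V b z)%R /\ (t%:Z < dot V b D - dot V b z)%R |
          (dot V b z < - t%:Z)%R /\ (dot V b D - dot V b z < - t%:Z)%R].
Proof.
move: {2}#|V| (erefl #|V|) => j; elim: j V A t m mu D => [|j IHj] V A t m mu D cV.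
  by move=> _ _ [u]; rewrite (cards0_eq cV) inE.
rewrite cV [dbound _ _ _ _]/=; set t' := 2 * t + _ => A0 mP largeD.
have [[a [ale [v vV av0] asmall]] | nosmall] := classic (exists a : T -> int,
  [/\ forall u, u \in V -> `|a u|%N <= A, exists2 v, v \in V & a v <> 0%R &
      `|dot V a D|%N <= t']).
  wlog av_gt0 : a ale av0 asmall / (0 < a v)%R.
    move=> wl; case: (ltrP 0 (a v)) => [|av]; first exact: (wl a).
    apply: (wl (fun u => - a u)%R) => [u /ale|||]; try lia.
    have -> : dot V (fun u => - a u)%R D = (- dot V a D)%R.
      by rewrite /dot -sumrN; apply: eq_bigr => u _; rewrite mulNr.
    by rewrite abszN.
  set V' := V :\ v.
  have cV' : #|V'| = j by move: cV; rewrite (cardsD1 v) vV => -[].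
  set mv := m * `|a v|.
  have mvE : (mv%:Z = m%:Z * a v)%R by rewrite /mv PoszM; congr (_ * _)%R; lia.
  have avA := ale v vV.
  have largeD' : exists2 u, u \in V' &
     dbound #|V'| (2 * (A * A)) (A * (t + t')) (A * mu) < `|D u|%N.
    rewrite cV'; set B := dbound _ _ _ _ in largeD *.
    apply: NNPP => nolarge.
    have small u : u \in V' -> `|D u|%N <= B.
      by move=> uV'; rewrite leqNgt; apply/negP => h; apply: nolarge; exists u.
    have [u uV] := largeD.
    have BAB : B <= A * B by rewrite leq_pmull.
    have [uv | uv] := eqVneq u v; last first.
      have /small : u \in V' by rewrite in_setD1 uv.
      by rewrite mulSn; lia.
    have le' : `|dot V' a D|%N <= j * (A * B).
      rewrite -cV'; apply: dot_abs_le => // x; rewrite in_setD1 => /andP[_]; exact: ale.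
    have := asmall; rewrite (dot_setD1 _ _ vV) -/V' uv => h.
    have : `|D v|%N <= `|(a v * D v)%R|%N by rewrite abszM leq_pmull //; lia.
    rewrite mulSn; move: (j * _) le' => jAB le'; move: h le'.
    move: (a v * D v)%R (dot _ _ _) => x y; lia.
  have A'0 : 0 < 2 * (A * A) by rewrite !muln_gt0 A0.
  have mvP : 0 < mv <= A * mu.
    by rewrite /mv muln_gt0 (mulnC A) leq_mul //; lia.
  have [c' [[u0 u0V' zu0] c'P]] := IHj V' _ _ _ _ D cV' A'0 mvP largeD'.
  pose c u := if u == v then (- \sum_(x in V') a x * c' x)%R else (a v * c' u)%R.
  pose z' u := (mv%:Z * c' u)%R; pose z u := (m%:Z * c u)%R.
  have zz' u : u \in V' -> z u = z' u.
    by rewrite in_setD1 => /andP[/negPf uv _]; rewrite /z /z' /c uv mvE mulrA.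
  exists c; split.
    exists u0; first by move: u0V'; rewrite in_setD1 => /andP[].
    by rewrite -/(z u0) zz'.
  move=> b ble; rewrite -/z.
  pose b' u := (a v * b u - b v * a u)%R.
  have b'le u : u \in V' -> `|b' u|%N <= 2 * (A * A).
    rewrite in_setD1 => /andP[_ uV]; rewrite /b'.
    have : `|(a v * b u)%R|%N <= A * A by rewrite abszM leq_mul ?ble.
    have : `|(b v * a u)%R|%N <= A * A by rewrite abszM leq_mul ?ble ?ale.
    lia.
  have dotb' x : (dot V' b' x = a v * dot V' b x - b v * dot V' a x)%R.
    rewrite /dot !mulr_sumr -sumrB; apply: eq_bigr => u _; rewrite /b'; ring.
  have dotV' b0 : dot V' b0 z = dot V' b0 z'.
    by rewrite /dot; apply: eq_bigr => u uV'; rewrite zz'.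
  have zv : (a v * z v = - dot V' a z')%R.
    rewrite /z /c eqxx /dot !mulrN; congr (- _)%R; rewrite !mulr_sumr.
    by apply: eq_bigr => u _; rewrite /z' mvE; ring.
  have eqz : (a v * dot V b z = dot V' b' z')%R.
    by rewrite (dot_setD1 _ _ vV) -/V' dotb' dotV' mulrDr mulrCA zv; ring.
  have eqD : (a v * dot V b D = dot V' b' D + b v * dot V a D)%R.
    by rewrite !(dot_setD1 _ _ vV) -/V' dotb'; ring.
  have sm : `|(b v * dot V a D)%R|%N <= A * t' by rewrite abszM leq_mul ?ble.
  have eqDz : (a v * (dot V b D - dot V b z) =
     (dot V' b' D - dot V' b' z') + b v * dot V a D)%R by rewrite mulrBr eqD eqz; ring.
  have avt : (a v * t%:Z <= (A * t)%:Z)%R.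
    by rewrite PoszM ler_pM //; lia.
  have lt_av x : ((A * t)%:Z < a v * x -> t%:Z < x)%R.
    by move=> h; rewrite -(ltr_pM2l av_gt0); apply: le_lt_trans avt h.
  have gt_av x : (a v * x < - (A * t)%:Z -> x < - t%:Z)%R.
    move=> h; rewrite -(ltr_pM2l av_gt0) mulrN; apply: lt_le_trans h _.
    by rewrite lerN2.
  have AD : A * (t + t') = A * t + A * t' by rewrite mulnDr.
  move: (c'P b' b'le); rewrite -/z' AD => -[z0 | [p1 p2] | [p1 p2]].
  - apply: Or31; apply: (mulfI (lt0r_neq0 av_gt0)).
    by rewrite eqz z0 mulr0.
  - by apply: Or32; split; apply: lt_av; rewrite ?eqz ?eqDz; lia.
  - by apply: Or33; split; apply: gt_av; rewrite ?eqz ?eqDz; lia.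
pose c u := (D u %/ (2 * m)%:Z)%Z; pose z u := (m%:Z * c u)%R.
pose r u := (D u %% (2 * m)%:Z)%Z.
have m20 : ((2 * m)%:Z != 0)%R by lia.
have DE u : (D u = 2%:Z * z u + r u)%R.
  by rewrite {1}(divz_eq (D u) (2 * m)%:Z) -/(c u) -/(r u) /z PoszM; ring.
have rle u : `|r u|%N <= 2 * m.
  have := modz_ge0 (D u) m20; have : (r u < (2 * m)%:Z)%R by apply: ltz_pmod; lia.
  rewrite /r; lia.
have main b : (forall u, u \in V -> `|b u|%N <= A) -> (exists2 v, v \in V & b v <> 0%R) ->
    (t%:Z < dot V b z)%R /\ (t%:Z < dot V b D - dot V b z)%R \/
    (dot V b z < - t%:Z)%R /\ (dot V b D - dot V b z < - t%:Z)%R.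
  move=> ble bn0.
  have big : t' < `|dot V b D|%N.
    by rewrite ltnNge; apply/negP => h; apply: nosmall; exists b.
  have dE : (dot V b D = 2%:Z * dot V b z + dot V b r)%R.
    rewrite /dot mulr_sumr -big_split; apply: eq_bigr => u _ /=; rewrite {1}DE; ring.
  have := dot_abs_le (C := 2 * m) ble (fun u _ => rle u); rewrite cV.
  have : j.+1 * (A * (2 * m)) <= 2 * (j.+1 * (A * mu)).
    have -> : 2 * (j.+1 * (A * mu)) = j.+1 * (A * (2 * mu)) by lia.
    by rewrite leq_mul2l leq_mul2l leq_mul2l; case/andP: mP => _ ->; rewrite !orbT.
  move: big; rewrite /t' dE; move: (_ * (A * mu)) (_ * (A * (2 * m))) => x y; lia.
have [v0 v0V _] := largeD.
exists c; split.
  exists v0 => //; rewrite -/(z v0) -(dot_unit z v0V).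
  case: (main (fun u => nat_of_bool (u == v0))).
  - by move=> u _; case: eqP => _; lia.
  - by exists v0 => //; rewrite eqxx.
  - by move=> [h _]; lia.
  - by move=> [h _]; lia.
move=> b ble; rewrite -/z.
have [bn0 | b0] := classic (exists2 v, v \in V & b v <> 0%R).
  by case: (main b ble bn0) => h; [apply: Or32 | apply: Or33].
apply: Or31; rewrite /dot big1 // => u uV.
have [-> | bu] := eqVneq (b u) 0%R; first by rewrite mul0r.
by case: b0; exists u => //; apply/eqP.
Qed.

Lemma dbound_le j A t mu : 0 < A ->
  dbound j A t mu <= (t + mu) * (2 * A) ^ (12 * 2 ^ j - 2 * j - 12).
Proof.
elim: j A t mu => [//|j IHj] A t mu A0; rewrite [dbound _ _ _ _]/=.
set t' := 2 * t + _; set B := dbound _ _ _ _.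
set ej := 12 * 2 ^ j - 2 * j - 12.
have -> : 12 * 2 ^ j.+1 - 2 * j.+1 - 12 = 2 * ej + (2 * j + 10).
  have : j < 2 ^ j by apply: ltn_expl.
  by rewrite expnS /ej; lia.
have hB : B <= (A * (t + t' + mu)) * (2 * A) ^ (2 * ej).
  apply: leq_trans (IHj _ _ _ _) _; first by rewrite !muln_gt0 A0.
  have -> : 2 * (2 * (A * A)) = (2 * A) ^ 2 by ring.
  by rewrite -expnM -mulnDr.
have ht : t + t' + mu <= (t + mu) * (A * (2 * j + 3)).
  have -> : (t + mu) * (A * (2 * j + 3)) =
    2 * (t * A * j) + 3 * (t * A) + 2 * (mu * A * j) + 3 * (mu * A) by ring.
  have -> : t' = 2 * t + 2 * (mu * A * j) + 2 * (mu * A) by rewrite /t'; ring.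
  have : t <= t * A by rewrite leq_pmulr.
  have : mu <= mu * A by rewrite leq_pmulr.
  by lia.
set P := (2 * A) ^ (2 * ej).
have P0 : 0 < P by rewrite expn_gt0 muln_gt0 A0.
have ht' : t' <= (t + mu) * (A * (2 * j.+1)).
  have -> : (t + mu) * (A * (2 * j.+1)) =
    2 * (t * A * j) + 2 * (t * A) + 2 * (mu * A * j) + 2 * (mu * A) by ring.
  have -> : t' = 2 * t + 2 * (mu * A * j) + 2 * (mu * A) by rewrite /t'; ring.
  have : t <= t * A by rewrite leq_pmulr.
  by lia.
have leA : 2 <= 2 * A by lia.
have exp2A n : 2 ^ n <= (2 * A) ^ n by case: n => // n; rewrite leq_exp2r.
have jlt : j < 2 ^ j by apply: ltn_expl.
apply: (@leq_trans ((t + mu) * P * (A * A * A * (j.+1 * (2 * j + 5))))); last first.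
  rewrite expnD -/P [leqRHS]mulnA leq_mul2l; apply/orP; right.
  have -> : 2 * j + 10 = 3 + (j + (j + 7)) by lia.
  rewrite expnD; apply: leq_mul.
    rewrite (expnMn 2 A 3) -mulnA mulnA; apply: leq_trans (leq_pmull _ (isT : 0 < 2 ^ 3)).
    by rewrite !expnS expn0 muln1 mulnA.
  rewrite expnD; apply: leq_mul; first exact: leq_trans (exp2A j).
  by apply: leq_trans (exp2A _); rewrite expnD; lia.
have -> : (t + mu) * P * (A * A * A * (j.+1 * (2 * j + 5))) =
   j.+1 * (A * (A * ((t + mu) * (A * (2 * j + 3))) * P)) +
   (t + mu) * (A * (2 * j.+1)) * (A * A * P) by ring.
apply: leq_add.
  rewrite !leq_mul2l; apply/orP; right; apply/orP; right.
  by apply: leq_trans hB _; rewrite leq_mul2r leq_mul2l ht !orbT.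
by apply: leq_trans ht' _; rewrite leq_pmulr // !muln_gt0 A0.
Qed.

Section Descent.

Variables (T J : finType) (M : {set T}) (R : {set J}) (c : J -> {set T} -> nat).

Definition excess (r : J) (y : T -> nat) : nat :=
  \max_(A : {set T} | A \subset M) (c r A - \sum_(v in A) y v).

Definition objective (y : T -> nat) : nat :=
  \sum_(v in M) y v + \sum_(r in R) excess r y.

Lemma excess_attained r y : exists A : {set T},
  [/\ A \subset M, \sum_(v in A) y v <= c r A & excess r y = c r A - \sum_(v in A) y v].
Proof.
have card0 : 0 < #|[pred A : {set T} | A \subset M]|.
  by apply/card_gt0P; exists set0; rewrite inE sub0set.
have [A AM exA] := eq_bigmax_cond (fun A : {set T} => c r A - \sum_(v in A) y v) card0.
have [le | lt] := leqP (\sum_(v in A) y v) (c r A); first by exists A.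
exists set0; rewrite sub0set big_set0 subn0; split=> //.
have ex0 : excess r y = 0 by rewrite /excess exA; lia.
apply/eqP; rewrite eqn_leq ex0 /= -ex0.
by apply: leq_trans (leq_bigmax_cond _ (sub0set M)); rewrite big_set0 subn0.
Qed.

Lemma excess_ge r y (A : {set T}) : A \subset M -> c r A <= excess r y + \sum_(v in A) y v.
Proof.
move=> AM; rewrite addnC -leq_subLR.
exact: (@leq_bigmax_cond _ (fun A : {set T} => A \subset M)
  (fun A : {set T} => c r A - \sum_(v in A) y v) A AM).
Qed.

Lemma excess_exchange r y ys y1 y2 :
  (forall v, v \in M -> y1 v + y2 v = y v + ys v) ->
  (forall A B : {set T}, A \subset M -> B \subset M ->
    \sum_(v in A) y1 v + \sum_(v in B) y v < \sum_(v in B) y1 v + \sum_(v in A) y v ->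
    \sum_(v in A) y2 v + \sum_(v in B) y v <= \sum_(v in B) y2 v + \sum_(v in A) y v) ->
  excess r y1 + excess r y2 <= excess r y + excess r ys.
Proof.
move=> sumE comp.
have sE (A : {set T}) : A \subset M ->
    \sum_(v in A) y1 v + \sum_(v in A) y2 v = \sum_(v in A) y v + \sum_(v in A) ys v.
  move=> AM; rewrite -!big_split; apply: eq_bigr => v vA.
  exact: sumE (subsetP AM v vA).
have [A [AM leA ->]] := excess_attained r y1; have [B [BM leB ->]] := excess_attained r y2.
have := excess_ge r y AM; have := excess_ge r y BM.
have := excess_ge r ys AM; have := excess_ge r ys BM.
have := sE A AM; have := sE B BM; have := comp A B AM BM.
case: ltnP => [lt /(_ isT) | ge _]; lia.
Qed.

Lemma objective_exchange y ys y1 y2 :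
  (forall v, v \in M -> y1 v + y2 v = y v + ys v) ->
  (forall A B : {set T}, A \subset M -> B \subset M ->
    \sum_(v in A) y1 v + \sum_(v in B) y v < \sum_(v in B) y1 v + \sum_(v in A) y v ->
    \sum_(v in A) y2 v + \sum_(v in B) y v <= \sum_(v in B) y2 v + \sum_(v in A) y v) ->
  objective y1 + objective y2 <= objective y + objective ys.
Proof.
move=> sumE comp; rewrite /objective addnACA [leqRHS]addnACA -!big_split /=; apply: leq_add.
  by rewrite (eq_bigr _ sumE).
by apply: leq_sum => r _; apply: excess_exchange.
Qed.

Let zsum (A : {set T}) (x : T -> int) : int := (\sum_(v in A) x v)%R.

Lemma dot_indicators (A B : {set T}) (x : T -> int) : A \subset M -> B \subset M ->
  (dot M (fun v => (v \in A)%:Z - (v \in B)%:Z) x = zsum A x - zsum B x)%R.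
Proof.
have one (C : {set T}) : C \subset M -> (\sum_(v in M) (v \in C)%:Z * x v = \sum_(v in C) x v)%R.
  move=> CM; rewrite (big_setID C) /= (setIidPr CM) [X in (_ + X)%R]big1 ?addr0.
    by apply: eq_bigr => v ->; rewrite mul1r.
  by move=> v; rewrite in_setD => /andP[/negPf-> _]; rewrite mul0r.
move=> AM BM; rewrite /zsum -(one A) // -(one B) // -sumrB /dot.
by apply: eq_bigr => v _; rewrite mulrBl.
Qed.

Lemma posz_sum (A : {set T}) (f : T -> nat) :
  ((\sum_(v in A) f v)%N%:Z = \sum_(v in A) (f v)%:Z)%R.
Proof. exact: (big_morph Posz PoszD (erefl _)). Qed.

(* A better point far from [y] splits as a sum of two displacements from [y], both
   shorter, at least one of which improves on [y]. *)
Lemma improving_step y ys : objective ys < objective y ->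
  exists2 y', objective y' < objective y &
    forall v, v \in M -> `|((y' v)%:Z - (y v)%:Z)%R|%N <= 2 ^ (12 * 2 ^ #|M|).
Proof.
pose dist y' := \sum_(v in M) `|((y' v)%:Z - (y v)%:Z)%R|%N.
have [N] := ubnP (dist ys); elim: N ys => // N IHN ys; rewrite ltnS => distN better.
pose D v := ((ys v)%:Z - (y v)%:Z)%R.
have [large | small] := classic (exists2 u, u \in M & dbound #|M| 1 0 1 < `|D u|%N); last first.
  exists ys => // v vM; apply: leq_trans (_ : dbound #|M| 1 0 1 <= _).
    by rewrite leqNgt; apply/negP => h; apply: small; exists v.
  apply: leq_trans (dbound_le _ _ _ _) _ => //.
  by rewrite add0n mul1n muln1 leq_exp2l //; lia.
have [c0 [[u uM zu0] zP]] := sign_compatible_summand (isT : 0 < 1) (isT : 0 < 1 <= 1) large.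
set z := fun v => _ in zu0 zP.
have zv v : v \in M -> [\/ z v = 0%R, (0 < z v)%R /\ (0 < D v - z v)%R |
    (z v < 0)%R /\ (D v - z v < 0)%R].
  move=> vM; have := zP (fun x => nat_of_bool (x == v)); rewrite !dot_unit // oppr0.
  by apply=> x _; case: eqP.
pose y1 v := `|((y v)%:Z + z v)%R|%N; pose y2 v := `|((ys v)%:Z - z v)%R|%N.
have y1E v : v \in M -> ((y1 v)%:Z = (y v)%:Z + z v)%R.
  by move=> vM; have := zv v vM; rewrite /y1 /D => -[?|[? ?]|[? ?]]; lia.
have y2E v : v \in M -> ((y2 v)%:Z = (ys v)%:Z - z v)%R.
  by move=> vM; have := zv v vM; rewrite /y2 /D => -[?|[? ?]|[? ?]]; lia.
have sumE v : v \in M -> y1 v + y2 v = y v + ys v.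
  by move=> vM; have := y1E v vM; have := y2E v vM; lia.
have comp (A B : {set T}) : A \subset M -> B \subset M ->
    \sum_(v in A) y1 v + \sum_(v in B) y v < \sum_(v in B) y1 v + \sum_(v in A) y v ->
    \sum_(v in A) y2 v + \sum_(v in B) y v <= \sum_(v in B) y2 v + \sum_(v in A) y v.
  move=> AM BM lt.
  have hb v : v \in M -> `|((v \in A)%:Z - (v \in B)%:Z)%R|%N <= 1.
    by case: (v \in A); case: (v \in B).
  have := zP _ hb; rewrite !dot_indicators // => h.
  have s1 (C : {set T}) : C \subset M ->
      ((\sum_(v in C) y1 v)%N%:Z = (\sum_(v in C) y v)%N%:Z + zsum C z)%R.
    move=> CM; rewrite /zsum !posz_sum -big_split; apply: eq_bigr => v vC.
    exact: y1E (subsetP CM v vC).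
  have s2 (C : {set T}) : C \subset M ->
      ((\sum_(v in C) y2 v)%N%:Z = (\sum_(v in C) y v)%N%:Z +
        (zsum C D - zsum C z))%R.
    move=> CM; rewrite /zsum !posz_sum -sumrB -big_split; apply: eq_bigr => v vC /=.
    by rewrite (y2E v (subsetP CM v vC)) /D; ring.
  have := s1 A AM; have := s1 B BM; have := s2 A AM; have := s2 B BM.
  by case: h => [h1|[h1 h2]|[h1 h2]]; lia.
have := objective_exchange sumE comp.
have zlt : `|z u|%N < `|D u|%N /\ `|(D u - z u)%R|%N < `|D u|%N.
  by case: (zv u uM) => [/zu0 //|[? ?]|[? ?]]; lia.
have zle v : v \in M -> `|z v|%N <= `|D v|%N /\ `|(D v - z v)%R|%N <= `|D v|%N.
  by move=> vM; have := zv v vM => -[?|[? ?]|[? ?]]; lia.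
have dist1 : dist y1 < dist ys.
  rewrite /dist (bigD1 u) //= [ltnRHS](bigD1 u) //= -addSn; apply: leq_add.
    by rewrite y1E // addrAC subrr add0r; case: zlt.
  apply: leq_sum => v /andP[vM _].
  by rewrite y1E // addrAC subrr add0r; case: (zle v vM).
have dist2 : dist y2 < dist ys.
  rewrite /dist (bigD1 u) //= [ltnRHS](bigD1 u) //= -addSn; apply: leq_add.
    by rewrite y2E // addrAC; case: zlt.
  apply: leq_sum => v /andP[vM _].
  by rewrite y2E // addrAC; case: (zle v vM).
move=> exch; have [b1 | nb1] := ltnP (objective y1) (objective y).
  exact: (IHN y1 (leq_trans dist1 distN)).
by apply: (IHN y2 (leq_trans dist2 distN)); lia.
Qed.

End Descent.

(** * Hall's theorem and colorings *)

Lemma hall (L S : finType) (N : L -> {set S}) (U : {set L}) :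
  (forall U' : {set L}, U' \subset U -> #|U'| <= #|\bigcup_(u in U') N u|) ->
  exists2 f : L -> option S,
    (forall u, u \in U -> exists2 s, s \in N u & f u = Some s) & {in U &, injective f}.
Proof.
have [m] := ubnP #|U|; elim: m N U => // m IHm N U; rewrite ltnS => cU hallU.
have [-> | [u0 u0U]] := set_0Vmem U.
  by exists (fun=> None) => // u; rewrite inE.
case: (boolP [exists U1 : {set L}, [&& U1 \proper U, U1 != set0 &
    #|\bigcup_(u in U1) N u| <= #|U1|]]) => [/existsP[U1 /and3P[U1U U1n0 tight]] | noTight].
  have sU1 := proper_sub U1U.
  have [|U' sU'|f1 f1N f1inj] := IHm N U1.
  - by apply: leq_trans (proper_card U1U) cU.
  - exact: hallU (subset_trans sU' sU1).
  pose N1 := \bigcup_(u in U1) N u.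
  have [||f2 f2N f2inj] := IHm (fun u => N u :\: N1) (U :\: U1).
  - apply: leq_trans cU; rewrite cardsD (setIidPr sU1) -subn_gt0 subKn ?card_gt0 //.
    exact: subset_leq_card.
  - move=> U' sU'.
    have dis : [disjoint U' & U1].
      rewrite disjoint_subset; apply/subsetP => x /(subsetP sU').
      by rewrite !inE => /andP[].
    have := hallU (U' :|: U1); rewrite subUset sU1 (subset_trans sU' (subsetDl _ _)).
    move=> /(_ isT); rewrite bigcup_setU -/N1.
    have [_] := leq_card_setU U' U1; rewrite dis => /eqP -> le.
    have : \bigcup_(u in U') N u :|: N1 \subset \bigcup_(u in U') (N u :\: N1) :|: N1.
      rewrite subUset subsetUr andbT; apply/bigcupsP => u uU'; apply/subsetP => s sN.
      rewrite in_setU; case: (boolP (s \in N1)) => sN1; rewrite ?orbT // orbF.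
      by apply/bigcupP; exists u => //; rewrite in_setD sN1.
    move=> /subset_leq_card; have [+ _] := leq_card_setU (\bigcup_(u in U') (N u :\: N1)) N1.
    rewrite -/N1 in tight; lia.
  have f1N1 u s : u \in U1 -> f1 u = Some s -> s \in N1.
    by move=> uU1 fu; have [t tN] := f1N u uU1; rewrite fu => -[->]; apply/bigcupP; exists u.
  have f2N1 u s : u \in U -> u \notin U1 -> f2 u = Some s -> s \notin N1.
    move=> uU uU1 fu; have [|t] := f2N u; first by rewrite in_setD uU1.
    by rewrite in_setD fu => /andP[tN1 _] [->].
  exists (fun u => if u \in U1 then f1 u else f2 u) => [u uU | u v uU vU].
    case: ifPn => uU1; first exact: f1N.
    have [|s] := f2N u; first by rewrite in_setD uU1.
    by rewrite in_setD => /andP[_ sN] fu; exists s.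
  case: ifPn => uU1; case: ifPn => vU1; first exact: f1inj.
  - have [s _ fu] := f1N u uU1; rewrite fu => /esym fv.
    by case/negP: (f2N1 v s vU vU1 fv); apply: f1N1 fu.
  - have [s _ fv] := f1N v vU1; rewrite fv => fu.
    by case/negP: (f2N1 u s uU uU1 fu); apply: f1N1 fv.
  - by apply: f2inj; rewrite in_setD ?uU1 ?vU1.
have [r0 r0N] : exists r0, r0 \in N u0.
  apply/set0Pn; rewrite -card_gt0; have := hallU [set u0].
  by rewrite sub1set u0U cards1 big_set1; apply.
have [||f fN finj] := IHm (fun u => N u :\ r0) (U :\ u0).
- by move: cU; rewrite (cardsD1 u0) u0U.
- move=> U' sU'; have [-> | U'n0] := eqVneq U' set0; first by rewrite cards0.
  have prop : U' \proper U by apply: sub_proper_trans sU' (properD1 u0U).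
  have : #|U'| < #|\bigcup_(u in U') N u|.
    rewrite ltnNge; apply: contra noTight => tight.
    by apply/existsP; exists U'; rewrite prop U'n0.
  have : \bigcup_(u in U') N u \subset r0 |: \bigcup_(u in U') (N u :\ r0).
    apply/bigcupsP => u uU'; apply/subsetP => s sN; rewrite in_setU1.
    case: eqP => //= /eqP sr; apply/bigcupP; exists u => //.
    by rewrite in_setD1 sr.
  move=> /subset_leq_card; have := cardsU1 r0 (\bigcup_(u in U') (N u :\ r0)).
  lia.
have fr0 u : u \in U -> u != u0 -> f u <> Some r0.
  move=> uU uu0 fu; have [|s] := fN u; first by rewrite in_setD1 uu0.
  by rewrite in_setD1 fu => /andP[sr _] [sE]; rewrite sE eqxx in sr.
exists (fun u => if u == u0 then Some r0 else f u) => [u uU | u v uU vU].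
  case: eqP => [-> | /eqP uu0]; first by exists r0.
  have [|s] := fN u; first by rewrite in_setD1 uu0.
  by rewrite in_setD1 => /andP[_ sN] fu; exists s.
case: eqP => [-> | /eqP uu0]; case: eqP => [-> // | /eqP vu0].
- by move/esym/(fr0 v vU vu0).
- by move/(fr0 u uU uu0).
- by apply: finj; rewrite in_setD1 ?uu0 ?vu0.
Qed.

Lemma hall_deficiency (L S : finType) (N : L -> {set S}) (U : {set L}) (d : nat) :
  (forall U' : {set L}, U' \subset U -> #|U'| <= #|\bigcup_(u in U') N u| + d) ->
  exists f : L -> option S,
    [/\ forall u s, u \in U -> f u = Some s -> s \in N u,
        forall u v s, u \in U -> v \in U -> f u = Some s -> f v = Some s -> u = v &
        #|[set u in U | f u == None]| <= d].
Proof.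
move=> hallU.
pose N' u : {set S + 'I_d} := [set x | if x is inl s then s \in N u else true].
have [U' sU' | f fN finj] := @hall L _ N' U.
  have [-> | [u0 u0U']] := set_0Vmem U'; first by rewrite cards0.
  apply: leq_trans (hallU _ sU') _.
  apply: leq_trans (_ : #|(inl @: \bigcup_(u in U') N u) :|: (inr @: [set: 'I_d])| <= _).
    have [_] := leq_card_setU (@inl S 'I_d @: \bigcup_(u in U') N u) (inr @: [set: 'I_d]).
    rewrite !card_imset ?cardsT ?card_ord; try by move=> ? ? [].
    suff -> : [disjoint (@inl S 'I_d) @: \bigcup_(u in U') N u & inr @: [set: 'I_d]].
      by move/eqP->.
    by rewrite disjoint_subset; apply/subsetP => x /imsetP[s _ ->]; rewrite inE; apply/imsetP => -[].
  apply: subset_leq_card; rewrite subUset; apply/andP; split; apply/subsetP => x /imsetP[].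
    by move=> s /bigcupP[u uU' sN] ->; apply/bigcupP; exists u; rewrite ?inE.
  by move=> i _ ->; apply/bigcupP; exists u0; rewrite ?inE.
pose g u : option S := if f u is Some (inl s) then Some s else None.
have gf u s : g u = Some s -> f u = Some (inl s) by rewrite /g; case: (f u) => [[t|i]|] // [->].
exists g; split=> [u s uU /gf fu | u v s uU vU /gf fu /gf fv |].
- by have [x xN] := fN u uU; rewrite fu => -[xE]; move: xN; rewrite -xE inE.
- by apply: finj; rewrite // fu.
have sub : f @: [set u in U | g u == None] \subset Some @: (inr @: [set: 'I_d]).
  apply/subsetP => x /imsetP[u]; rewrite inE => /andP[uU gu] ->.
  have [[s|i] _ fu] := fN u uU; first by rewrite /g fu in gu.
  by rewrite fu; do 2!apply: imset_f; rewrite inE.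
rewrite -(card_in_imset (f := f)); last first.
  by move=> u v; rewrite !inE => /andP[uU _] /andP[vU _]; apply: finj.
apply: leq_trans (subset_leq_card sub) _.
apply: leq_trans (leq_imset_card _ _) _; apply: leq_trans (leq_imset_card _ _) _.
by rewrite cardsT card_ord.
Qed.

Section Classes.

Variables (T : finType) (e : rel T) (M R : {set T}) (rep : T -> T) (k : nat).

Definition cl (u v : T) : bool := (u == v) || e u v.
Definition mnbh (u : T) : {set T} := [set v in M | e u v].
Definition clique_of (r : T) : {set T} := [set u | (u \notin M) && cl r u].

(* [B c] lists the twin classes met by the [c]-th color class that contains a
   vertex of [M]. *)
Definition valid (B : 'I_k -> {set T}) : Prop :=
  [/\ forall c s, s \in B c -> rep s = s,
      forall v, v \in M -> exists c, v \in B c,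
      forall c s t, s \in B c -> t \in B c -> ~~ e s t,
      forall c, exists v, forall s, s \in B c -> cl v s &
      forall s, rep s = s -> #|[set c | s \in B c]| <= #|[set u | rep u == s]|].

Definition used (B : 'I_k -> {set T}) : nat := #|[set c | B c != set0]|.

Definition rest (B : 'I_k -> {set T}) (r : T) (A : {set T}) : nat :=
  #|[set u in clique_of r | mnbh u \subset A]| -
  \sum_(c < k) #|[set s in B c | (s \in clique_of r) && (mnbh s \subset A)]|.

Hypotheses (e_sym : symmetric e) (e_irr : irreflexive e).
Hypothesis cluster : forall u v x,
  u \notin M -> v \notin M -> x \notin M -> cl u v -> cl v x -> cl u x.
Hypothesis R_out : forall r, r \in R -> r \notin M.
Hypothesis R_ex : forall u, u \notin M -> exists2 r, r \in R & cl r u.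
Hypothesis R_uniq : forall r r', r \in R -> r' \in R -> cl r r' -> r = r'.
Hypothesis rep_idem : forall u, rep (rep u) = rep u.
Hypothesis rep_M : forall u, u \in M -> rep u = u.
Hypothesis rep_out : forall u, u \notin M -> rep u \notin M.
Hypothesis rep_cl : forall u x, cl (rep u) x = cl u x.

Lemma clC u v : cl u v = cl v u.
Proof. by rewrite /cl eq_sym e_sym. Qed.

Lemma cl_dominates v (S : {set T}) : reflect (forall s, s \in S -> cl v s) (dominates e v S).
Proof.
apply: (iffP subsetP) => h s /h; rewrite !inE /cl eq_sym orbC //.
Qed.

Lemma rep_mem u : (rep u \in M) = (u \in M).
Proof.
by case: (boolP (u \in M)) => uM; [rewrite rep_M | apply/negbTE/rep_out].
Qed.

Lemma mnbh_rep u : u \notin M -> mnbh (rep u) = mnbh u.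
Proof.
move=> uM; apply/setP => v; rewrite !inE; case: (boolP (v \in M)) => //= vM.
have := rep_cl u v; rewrite /cl.
have -> : (u == v) = false by apply: contraNF uM => /eqP ->.
by have -> : (rep u == v) = false by apply: contraNF (rep_out uM) => /eqP ->.
Qed.

Lemma clique_rep r u : (rep u \in clique_of r) = (u \in clique_of r).
Proof. by rewrite !inE rep_mem (clC r) rep_cl clC. Qed.

Lemma clique_cl r u v : r \notin M -> u \in clique_of r -> v \in clique_of r -> cl u v.
Proof.
rewrite !inE => rM /andP[uM ru] /andP[vM rv].
by apply: (cluster uM rM vM) => //; rewrite clC.
Qed.

Lemma cl_rep u v : cl (rep u) (rep v) = cl u v.
Proof. by rewrite rep_cl clC rep_cl clC. Qed.

Definition root (u : T) : T := odflt u [pick r in R | cl r u].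

Lemma rootP u : u \notin M -> root u \in R /\ u \in clique_of (root u).
Proof.
move=> uM; rewrite /root; case: pickP => [r /andP[rR ru] | none] /=.
  by rewrite inE uM ru.
by have [r rR ru] := R_ex uM; have := none r; rewrite /= rR ru.
Qed.

Lemma root_uniq r u : r \in R -> u \in clique_of r -> root u = r.
Proof.
move=> rR; rewrite inE => /andP[uM ru]; have [tR] := rootP uM.
rewrite inE => /andP[_ tu]; apply: R_uniq => //.
by apply: (cluster (R_out tR) uM (R_out rR)) => //; rewrite clC.
Qed.

Section Sound.

Variables (B : 'I_k -> {set T}) (y : T -> nat).
Hypothesis Bok : valid B.

Let choice c s : T :=
  nth s (enum [set u | rep u == s]) (index c (enum [set d | s \in B d])).

Let choice_rep c s : s \in B c -> rep (choice c s) = s.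
Proof.
case: Bok => B0 _ _ _ B4 sB.
have : choice c s \in enum [set u | rep u == s].
  apply: mem_nth; rewrite -cardE; apply: leq_trans (B4 s (B0 c s sB)).
  by rewrite cardE index_mem mem_enum inE.
by rewrite mem_enum inE => /eqP.
Qed.

Let choice_inj c d s : s \in B c -> s \in B d -> choice c s = choice d s -> c = d.
Proof.
case: Bok => B0 _ _ _ B4 sc sd /eqP.
have ltn x : s \in B x -> index x (enum [set d | s \in B d]) < size (enum [set u | rep u == s]).
  move=> sx; rewrite -cardE; apply: leq_trans (B4 s (B0 x s sx)).
  by rewrite cardE index_mem mem_enum inE.
rewrite nth_uniq ?ltn ?enum_uniq // => /eqP h.
have := nth_index c (_ : c \in enum [set d | s \in B d]).
rewrite h nth_index; first by move=> -> //; rewrite mem_enum inE.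
by rewrite mem_enum inE.
Qed.

Let cls u : option 'I_k := [pick c | (rep u \in B c) && (choice c (rep u) == u)].

Let cls_some u c : cls u = Some c -> rep u \in B c /\ choice c (rep u) = u.
Proof. by rewrite /cls; case: pickP => // d /andP[hd /eqP hu] [<-]. Qed.

Let cls_choice c s : s \in B c -> cls (choice c s) = Some c.
Proof.
move=> sB; rewrite /cls; case: pickP => [d|/(_ c)]; rewrite choice_rep // ?sB ?eqxx //.
by case/andP=> sd /eqP h; congr Some; apply: choice_inj h.
Qed.

Let cls_M v : v \in M -> cls v <> None.
Proof.
case: Bok => _ B1 _ _ _ vM; have [c vc] := B1 v vM; have := cls_choice vc.
suff -> : choice c v = v by move=> ->.
have := choice_rep vc; move: (choice c v) => u ru.
have uM : u \in M by rewrite -rep_mem ru.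
by rewrite -(rep_M uM).
Qed.

Let left := [set u | cls u == None].

Let left_out u : u \in left -> u \notin M.
Proof. by rewrite inE => /eqP h; apply/negP => /cls_M. Qed.

Lemma left_rest r (A : {set T}) : r \notin M ->
  #|[set u in left :&: clique_of r | mnbh u \subset A]| <= rest B r A.
Proof.
move=> rM; rewrite /rest.
pose Z := [set u in clique_of r | mnbh u \subset A]; rewrite -/Z.
have -> : #|Z| = #|[set u in left :&: clique_of r | mnbh u \subset A]| +
    \sum_(c < k) #|[set u in Z | cls u == Some c]|.
  rewrite -sum1_card (partition_big cls predT) //= (bigD1 None) //=; congr (_ + _).
    rewrite -sum1_card; apply: eq_bigl => u; rewrite !inE.
    by rewrite andbC !andbA.
  rewrite (reindex_omap Some id) /=; last by case.
  apply: eq_big => [c | c _]; first by rewrite eqxx.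
  by rewrite -sum1_card; apply: eq_bigl => u; rewrite !inE.
rewrite -[leqLHS]addn0 -addnBA; first exact: leq_add.
apply: leq_sum => c _.
rewrite -(card_in_imset (f := choice c)); last first.
  move=> s t; rewrite !inE => /andP[sB _] /andP[tB _] h.
  by rewrite -(choice_rep sB) -(choice_rep tB) h.
apply/subset_leq_card/subsetP => u /imsetP[s]; rewrite inE => /and3P[sB sr sA] ->.
rewrite inE cls_choice // eqxx andbT inE -clique_rep choice_rep // sr /=.
by rewrite -mnbh_rep ?choice_rep //; rewrite -rep_mem choice_rep //; move: sr; rewrite inE => /andP[].
Qed.

Let N := (\sum_(v in M) y v).

Let slots u : {set T * 'I_N} := [set p : T * 'I_N | (p.1 \in mnbh u) && (p.2 < y p.1)].

Let card_slots (A : {set T}) : A \subset M ->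
  \sum_(v in A) y v = #|[set p : T * 'I_N | (p.1 \in A) && (p.2 < y p.1)]|.
Proof.
move=> AM; rewrite -sum1_card.
rewrite (eq_bigl (fun p : T * 'I_N => (p.1 \in A) && (p.2 < y p.1))); last by move=> p; rewrite inE.
rewrite -(pair_big_dep (fun v => v \in A) (fun v (i : 'I_N) => i < y v) (fun _ _ => 1)) /=.
apply: eq_bigr => v vA.
have vN : y v <= N by rewrite /N (bigD1 v) ?leq_addr //; apply: (subsetP AM).
rewrite -(big_ord_widen_cond N predT (fun=> 1) vN) /=.
by rewrite sum1_card card_ord.
Qed.

Lemma matching r : r \in R -> exists f : T -> option (T * 'I_N),
  [/\ forall u s, u \in left :&: clique_of r -> f u = Some s -> s \in slots u,
      forall u v s, u \in left :&: clique_of r -> v \in left :&: clique_of r ->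
        f u = Some s -> f v = Some s -> u = v &
      #|[set u in left :&: clique_of r | f u == None]| <= excess M (rest B) r y].
Proof.
move=> rR; apply: hall_deficiency => U sU.
pose A := \bigcup_(u in U) mnbh u.
have AM : A \subset M by apply/bigcupsP => u _; apply/subsetP => v; rewrite inE => /andP[].
have leU : #|U| <= rest B r A.
  apply: leq_trans (left_rest A (R_out rR)); apply/subset_leq_card/subsetP => u uU.
  by rewrite inE (subsetP sU) //=; apply: bigcup_sup.
apply: leq_trans leU _; apply: leq_trans (excess_ge (rest B) r y AM) _.
rewrite addnC leq_add2r (card_slots AM); apply/subset_leq_card/subsetP => p.
rewrite inE => /andP[/bigcupP[u uU pu] py]; apply/bigcupP; exists u => //.
by rewrite inE pu.
Qed.

Lemma sound : exists (C : finType) (chi : T -> C),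
  cd_coloring e chi /\ #|colors chi| <= used B + objective M R (rest B) y.
Proof.
have ex r : exists f : T -> option (T * 'I_N), r \in R ->
    [/\ forall u s, u \in left :&: clique_of r -> f u = Some s -> s \in slots u,
      forall u v s, u \in left :&: clique_of r -> v \in left :&: clique_of r ->
        f u = Some s -> f v = Some s -> u = v &
      #|[set u in left :&: clique_of r | f u == None]| <= excess M (rest B) r y].
  case: (boolP (r \in R)) => [/matching [f fP] | _]; first by exists f.
  by exists (fun=> None).
have [f fP] := fin_all_exists ex.
pose chi u : 'I_k + (T * 'I_N) + T :=
  if cls u is Some c then inl (inl c)
  else if f (root u) u is Some s then inl (inr s) else inr u.
have chi_cls u c : chi u = inl (inl c) -> cls u = Some c.
  by rewrite /chi; case: (cls u) => [d [->] // |]; case: (f _ _).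
have chi_slot u s : chi u = inl (inr s) -> u \in left /\ f (root u) u = Some s.
  rewrite /chi inE; case: (cls u) => // ; case fu: (f _ _) => [t|] // [<-].
  by rewrite eqxx.
have chi_single u v : chi u = inr v -> u = v /\ (u \in left) /\ f (root u) u = None.
  by rewrite /chi inE; case: (cls u) => //; case fu: (f _ _) => [t|] // [<-].
have left_root u : u \in left -> root u \in R /\ u \in left :&: clique_of (root u).
  move=> ul; have [rR ur] := rootP (left_out ul); split=> //.
  by rewrite in_setI ul.
have slot_nbh u v i : chi u = inl (inr (v, i)) -> v \in mnbh u /\ i < y v.
  move=> /chi_slot[ul fu]; have [rR ur] := left_root u ul; have [fS _ _] := fP _ rR.
  by have := fS u _ ur fu; rewrite inE => /andP[].
exists ('I_k + (T * 'I_N) + T)%type, chi; split; first split.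
- move=> u v uv; have clr : cl u v by rewrite /cl uv orbT.
  have unv : u <> v by move=> E; rewrite E e_irr in uv.
  case cu: (chi u) => [[c|s]|x] /esym cv.
  + have [uB uE] := cls_some (chi_cls _ _ cu); have [vB vE] := cls_some (chi_cls _ _ cv).
    have : cl (rep u) (rep v) by rewrite cl_rep.
    case/orP=> [/eqP E | ]; first by apply: unv; rewrite -uE -vE E.
    by case: Bok => _ _ B2 _ _; apply/negP; apply: B2 uB vB.
  + have [ul fu] := chi_slot _ _ cu; have [vl fv] := chi_slot _ _ cv.
    have [uR ur] := left_root u ul; have [vR vr] := left_root v vl.
    have rE : root v = root u.
      apply: (root_uniq uR); rewrite inE (left_out vl).
      move: ur; rewrite !inE => /and3P[_ uM ru].
      exact: (cluster (R_out uR) uM (left_out vl) ru clr).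
    have [_ fI _] := fP _ uR; apply: unv; rewrite rE in fv vr.
    exact: fI ur vr fu fv.
  + have [uE _] := chi_single _ _ cu; have [vE _] := chi_single _ _ cv.
    by apply: unv; rewrite uE vE.
- move=> x /imsetP[u0 _ xE].
  case: x xE => [[c|[v i]]|x] /esym xE.
  + case: Bok => _ _ _ B3 _; have [w wP] := B3 c; exists w; apply/cl_dominates => u.
    rewrite inE => /eqP /chi_cls/cls_some[uB _].
    by rewrite clC -rep_cl clC; apply: wP.
  + exists v; apply/cl_dominates => u; rewrite inE => /eqP /slot_nbh[].
    by rewrite inE /cl => /andP[_ uv] _; rewrite e_sym uv orbT.
  + exists x; apply/cl_dominates => u; rewrite inE => /eqP /chi_single[-> _].
    by rewrite /cl eqxx.
pose singles r := [set u in left :&: clique_of r | f r u == None].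
have sub : colors chi \subset (inl @: (inl @: [set c | B c != set0])) :|:
   ((inl @: (inr @: [set p : T * 'I_N | (p.1 \in M) && (p.2 < y p.1)])) :|:
    (inr @: \bigcup_(r in R) singles r)).
  apply/subsetP => x /imsetP[u _]; case: x => [[c|[v i]]|x] /esym xE; rewrite !in_setU.
  + apply/orP; left; do 2!apply: imset_f; rewrite inE; apply/set0Pn.
    by have [uB _] := cls_some (chi_cls _ _ xE); exists (rep u).
  + apply/orP; right; apply/orP; left; do 2!apply: imset_f; rewrite inE /=.
    by have [] := slot_nbh _ _ _ xE; rewrite inE => /andP[-> _] ->.
  + apply/orP; right; apply/orP; right; apply: imset_f.
    have [<- [ul fu]] := chi_single _ _ xE; have [uR ur] := left_root u ul.
    by apply/bigcupP; exists (root u); rewrite // inE ur fu eqxx.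
apply: leq_trans (subset_leq_card sub) _.
apply: leq_trans (leq_card_setU _ _) _; apply: leq_add.
  by apply: leq_trans (leq_imset_card _ _) _; apply: leq_imset_card.
apply: leq_trans (leq_card_setU _ _) _; apply: leq_add.
  rewrite (card_slots (subxx M)).
  by apply: leq_trans (leq_imset_card _ _) _; apply: leq_imset_card.
apply: leq_trans (leq_imset_card _ _) _.
apply: leq_trans (_ : \sum_(r in R) #|singles r| <= _); last first.
  by apply: leq_sum => r rR; have [] := fP r rR.
elim/big_ind2: _ => [|n1 m1 n2 m2 h1 h2|r _] //; first by rewrite cards0.
by apply: leq_trans (leq_card_setU _ _) _; apply: leq_add.
Qed.

End Sound.
Section Complete.

Variables (C : finType) (chi : T -> C).
Hypotheses (chiP : cd_coloring e chi) (kM : k = #|M|).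

Let CM : {set C} := [set chi v | v in M].
Let ix u : option 'I_k := insub (index (chi u) (enum CM)).
Let B c : {set T} := [set rep u | u in [set u | (chi u \in CM) && (ix u == Some c)]].
Let dm x : option T := [pick v | dominates e v (color_class chi x)].
Let free := colors chi :\: CM.
Let y v := #|[set x in free | dm x == Some v]|.

Let proper_cl u v : chi u = chi v -> cl u v -> u = v.
Proof. by move=> E /orP[/eqP // | uv]; case: chiP => /(_ u v uv). Qed.

Let ix_lt u : chi u \in CM -> index (chi u) (enum CM) < #|CM|.
Proof. by rewrite cardE index_mem mem_enum. Qed.

Let ix_some u : chi u \in CM -> exists c, ix u = Some c.
Proof.
move=> uC; have lt : index (chi u) (enum CM) < k.
  by rewrite kM; apply: leq_trans (ix_lt uC) (leq_imset_card _ _).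
by exists (Ordinal lt); rewrite /ix insubT.
Qed.

Let ix_val u c : ix u = Some c -> val c = index (chi u) (enum CM).
Proof. by rewrite /ix; case: insubP => // d _ dE [<-]. Qed.

Let ix_color u v c : chi u \in CM -> chi v \in CM -> ix u = Some c -> ix v = Some c ->
  chi u = chi v.
Proof.
move=> uC vC /ix_val uE /ix_val vE.
have uC' : chi u \in enum CM by rewrite mem_enum.
have vC' : chi v \in enum CM by rewrite mem_enum.
by rewrite -(nth_index (chi u) uC') -uE vE nth_index.
Qed.

Let dm_some u : exists2 v, dm (chi u) = Some v & forall s, chi s = chi u -> cl v s.
Proof.
case: chiP => _ dom; rewrite /dm; case: pickP => [v /cl_dominates vP | none].
  by exists v => // s E; apply: vP; rewrite inE E.
have [|v] := dom (chi u); first exact: imset_f.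
by have := none v => /= ->.
Qed.

Let BP c s : reflect (exists u, [/\ chi u \in CM, ix u = Some c & s = rep u]) (s \in B c).
Proof.
apply: (iffP imsetP) => [[u + ->] | [u [uC uc ->]]].
  by rewrite inE => /andP[uC /eqP uc]; exists u.
by exists u; rewrite // inE uC uc eqxx.
Qed.

Lemma complete_valid : valid B.
Proof.
split.
- by move=> c s /BP[u [_ _ ->]].
- move=> v vM; have vC : chi v \in CM by apply: imset_f.
  by have [c vc] := ix_some vC; exists c; apply/BP; exists v; rewrite rep_M.
- move=> c s t /BP[u [uC uc ->]] /BP[v [vC vc ->]]; apply/negP => st.
  have uv : u = v.
    by apply: proper_cl (ix_color uC vC uc vc) _; rewrite -cl_rep /cl st orbT.
  by rewrite uv e_irr in st.
- move=> c; have [B0 | [s0 /BP[u [uC uc _]]]] := set_0Vmem (B c).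
    have [v vM] : exists v, v \in M.
      by apply/set0Pn; rewrite -card_gt0 -kM; apply: leq_ltn_trans (ltn_ord c).
    by exists v => s; rewrite B0 inE.
  have [w _ wP] := dm_some u; exists w => s /BP[v [vC vc ->]].
  by rewrite clC rep_cl clC; apply: wP; apply: ix_color vc uc.
- move=> s _; rewrite -(card_imset (mem [set c | s \in B c]) (@Some_inj _)).
  apply: leq_trans (leq_imset_card ix _); apply/subset_leq_card/subsetP => x.
  case/imsetP=> c; rewrite inE => /BP[u [uC uc sE]] ->; rewrite -uc.
  by apply: imset_f; rewrite inE sE.
Qed.

Lemma complete_used : used B <= #|CM|.
Proof.
have CMk : #|CM| <= k by rewrite kM leq_imset_card.
apply: leq_trans (_ : #|widen_ord CMk @: [set: 'I_#|CM|]| <= _); last first.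
  by apply: leq_trans (leq_imset_card _ _) _; rewrite cardsT card_ord.
apply/subset_leq_card/subsetP => c; rewrite inE => /set0Pn[s /BP[u [uC /ix_val uc _]]].
by apply/imsetP; exists (Ordinal (ix_lt uC)) => //; apply: val_inj.
Qed.

Let rooted r := [set x in free | if dm x is Some w then w \in clique_of r else false].

Let card_free (P : pred C) : #|[set x in free | P x]| = \sum_(x in free) P x.
Proof.
by rewrite -sum1dep_card big_mkcondr; apply: eq_bigr => x _; case: (P x).
Qed.

Let yE v : y v = \sum_(x in free) (dm x == Some v).
Proof. exact: card_free. Qed.

Let rootedE r : #|rooted r| =
  \sum_(x in free) nat_of_bool (if dm x is Some w then w \in clique_of r else false).
Proof. exact: card_free. Qed.

Lemma complete_excess r : r \in R -> excess M (rest B) r y <= #|rooted r|.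
Proof.
move=> rR; have rM := R_out rR; apply/bigmax_leqP => A AM.
rewrite leq_subLR /rest leq_subLR.
set Z := [set u in clique_of r | _].
have Zcl u v : u \in Z -> v \in Z -> cl u v.
  rewrite [u \in Z]inE [v \in Z]inE => /andP[ur _] /andP[vr _].
  exact: clique_cl rM ur vr.
rewrite -(cardsID [set u | chi u \in CM] Z); apply: leq_add.
  set Z1 := Z :&: _.
  have -> : #|Z1| = \sum_(c < k) #|[set u in Z1 | ix u == Some c]|.
    rewrite -sum1_card (partition_big ix (fun x => x != None)) /=; last first.
      by move=> u; rewrite !inE => /andP[_ /ix_some[c ->]].
    rewrite (reindex_omap Some id) /=; last by case.
    by apply: eq_big => [c | c _]; rewrite ?eqxx // sum1dep_card cardsE.
  apply: leq_sum => c _; rewrite -(card_in_imset (f := rep)); last first.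
    move=> u v; rewrite [_ \in _]inE => /andP[/setIP[uZ uC] /eqP uc].
    rewrite [_ \in _]inE => /andP[/setIP[vZ vC] /eqP vc] _.
    rewrite !inE in uC vC.
    by apply: proper_cl; [apply: ix_color uc vc | apply: Zcl].
  apply/subset_leq_card/subsetP => s /imsetP[u]; rewrite [_ \in _]inE.
  move=> /andP[/setIP[uZ uC] /eqP uc] ->; rewrite inE in uC.
  move: uZ; rewrite [u \in Z]inE => /andP[ur uA].
  rewrite inE clique_rep ur mnbh_rep ?uA ?andbT; first by apply/BP; exists u.
  by move: ur; rewrite inE => /andP[].
set Z2 := Z :\: _.
rewrite -(card_in_imset (f := chi)); last first.
  move=> u v; rewrite !in_setD => /andP[_ uZ] /andP[_ vZ] E.
  exact: proper_cl E (Zcl _ _ uZ vZ).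
have sub : chi @: Z2 \subset free.
  by apply/subsetP => x /imsetP[u]; rewrite !inE => /andP[uC _] ->; rewrite uC imset_f.
have -> : #|chi @: Z2| = #|[set x in free | x \in chi @: Z2]|.
  by congr #|pred_of_set _|; apply/setP => x; rewrite [RHS]inE -in_setI (setIidPr sub).
rewrite card_free rootedE (eq_bigr _ (fun v _ => yE v)) exchange_big /= -big_split /=.
apply: leq_sum => x _.
case: (boolP (x \in chi @: Z2)) => // /imsetP[u uZ2 ->].
have [w dw wP] := dm_some u; rewrite dw.
move: uZ2; rewrite !inE => /and3P[uC /andP[uM ru] uA].
have wu := wP u erefl.
have [wM | wM] := boolP (w \in M); last first.
  rewrite (_ : cl r w) ?addn1 //.
  by apply: (cluster rM uM wM ru); rewrite clC.
have wA : w \in A.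
  apply: (subsetP uA); rewrite inE wM; case/orP: wu => [/eqP E | ]; last by rewrite e_sym.
  by rewrite E (negPf uM) in wM.
by rewrite (bigD1 w) //= eqxx.
Qed.

Lemma complete : exists (D : 'I_k -> {set T}) (z : T -> nat),
  valid D /\ used D + objective M R (rest D) z <= #|colors chi|.
Proof.
exists B, y; split; first exact: complete_valid.
have CMcol : CM \subset colors chi.
  by apply/subsetP => x /imsetP[v _ ->]; apply: imset_f.
rewrite -(cardsID CM (colors chi)) (setIidPr CMcol) -/free.
apply: leq_add; first exact: complete_used.
apply: leq_trans (_ : \sum_(v in M) y v + \sum_(r in R) #|rooted r| <= _).
  by rewrite leq_add2l; apply: leq_sum; apply: complete_excess.
rewrite (eq_bigr _ (fun v _ => yE v)) exchange_big /=.
rewrite [X in _ + X](eq_bigr _ (fun r _ => rootedE r)) [X in _ + X]exchange_big /=.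
rewrite -big_split -sum1_card; apply: leq_sum => x _ /=.
case: (dm x) => [w|]; last by rewrite !big1.
have [wM | wM] := boolP (w \in M).
  rewrite (bigD1 w) //= eqxx !big1 // => [r _ | v /andP[_ vw]].
    by rewrite inE wM.
  by case: eqP => // -[E]; rewrite E eqxx in vw.
rewrite big1 ?add0n; last first.
  by move=> v vM; case: eqP => // -[E]; rewrite E vM in wM.
have [rR wr] := rootP wM.
rewrite (bigD1 (root w)) //= wr big1 // => r /andP[rR' rw].
case: (boolP (w \in clique_of r)) => // /(root_uniq rR') E.
by rewrite E eqxx in rw.
Qed.

End Complete.

End Classes.

(** * Correctness and running time *)

Section BoundedOps.

Variable X : nat.

Lemma sumbE b f : b <= X -> sumb X b f = \sum_(i < b) f i.
Proof. by move=> bX; rewrite /sumb (minn_idPl bX) big_mkord. Qed.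

Lemma hasbP b (p : pred nat) : b <= X -> reflect (exists2 i, i < b & p i) (hasb X b p).
Proof.
move=> bX; rewrite /hasb (minn_idPl bX); apply: (iffP hasP) => [[i] | [i ib pi]].
  by rewrite mem_iota => ib pi; exists i.
by exists i; rewrite ?mem_iota.
Qed.

Lemma allbP b (p : pred nat) : b <= X -> reflect (forall i, i < b -> p i) (allb X b p).
Proof.
move=> bX; rewrite /allb (minn_idPl bX); apply: (iffP allP) => h i ib.
  by apply: h; rewrite mem_iota.
by apply: h; rewrite mem_iota in ib.
Qed.

Lemma iterbE b f x : b <= X -> iterb X b f x = iteri b f x.
Proof. by move=> bX; rewrite /iterb (minn_idPl bX). Qed.

Lemma mulE a b : a <= X -> mul X a b = a * b.
Proof. by move=> aX; rewrite /mul iterbE //; elim: a {aX} => //= a ->; rewrite mulSn addnC. Qed.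

Lemma divbE a b : 0 < b -> a %/ b <= X -> divb X a b = a %/ b.
Proof.
move=> b0 qX; rewrite /divb sumbE //.
rewrite (eq_bigr (fun t : 'I_X => if t < a %/ b then 1 else 0)); last first.
  by move=> t _; rewrite mulE // -leq_divRL //; case: leq.
by rewrite -big_mkcond /= -(big_ord_widen_cond X predT (fun=> 1) qX) sum1_card card_ord.
Qed.

Lemma modbE a b : 0 < b -> a %/ b <= X -> modb X a b = a %% b.
Proof. by move=> b0 qX; rewrite /modb divbE // mulE // {1}(divn_eq a b) addKn. Qed.

Lemma powbE b i : b <= X -> i <= X -> powb X b i = b ^ i.
Proof.
by move=> bX iX; rewrite /powb iterbE //; elim: i {iX} => //= i ->; rewrite mulE // expnS.
Qed.

Lemma digE b i a : 0 < b <= X -> i <= X -> a <= X -> dig X b i a = (a %/ b ^ i) %% b.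
Proof.
move=> /andP[b0 bX] iX aX; have bi0 : 0 < b ^ i by rewrite expn_gt0 b0.
have aX' c : a %/ b ^ i %/ c <= X.
  by apply: leq_trans (leq_div _ _) _; apply: leq_trans (leq_div _ _) _.
by rewrite /dig powbE // divbE ?modbE //; apply: leq_trans (leq_div _ _) _.
Qed.

Lemma pow2E i : i <= X -> pow2 X i = 2 ^ i.
Proof. by move=> iX; rewrite /pow2 iterbE //; elim: i {iX} => //= i ->; rewrite expnS mul2n addnn. Qed.

End BoundedOps.

Lemma double4E a : double4 a = 16 * a.
Proof. by rewrite /double4; lia. Qed.

Lemma iteri_double i a : iteri i (fun _ b => b + b) a = a * 2 ^ i.
Proof. by elim: i => [|i /= ->]; rewrite ?muln1 // expnS; lia. Qed.

Lemma sum_digits_lt b K f : (forall i, i < K -> f i < b) -> \sum_(i < K) f i * b ^ i < b ^ K.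
Proof.
elim: K => [|K IHK] fb; first by rewrite big_ord0.
rewrite big_ord_recr /= expnS.
have := IHK (fun i iK => fb i (leqW iK)); have := fb K (ltnSn K).
move: (\sum_(i < K) _) (b ^ K) => s P fK sP.
have : (f K).+1 * P <= b * P by rewrite leq_mul2r fK orbT.
lia.
Qed.

Lemma digit_of_sum b K f i : (forall i, i < K -> f i < b) -> i < K ->
  ((\sum_(j < K) f j * b ^ j) %/ b ^ i) %% b = f i.
Proof.
elim: K => // K IHK fb iK; have b0 : 0 < b by apply: leq_ltn_trans (fb K _).
have fb' j : j < K -> f j < b by move=> jK; apply: fb; apply: leqW.
rewrite big_ord_recr /=; move: iK; rewrite ltnS leq_eqVlt => /predU1P[-> | iK].
  rewrite addnC divnMDl ?expn_gt0 ?b0 //.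
  by rewrite divn_small ?sum_digits_lt // addn0 modn_small ?fb.
have -> : b ^ K = b * b ^ (K - i.+1) * b ^ i.
  by rewrite -expnS -expnD; congr (_ ^ _); lia.
rewrite mulnA addnC divnMDl ?expn_gt0 ?b0 // mulnCA mulnC.
by rewrite modnMDl IHK.
Qed.

Lemma nth_allpairs (S T U : Type) (f : S -> T -> U) (x : S) (y : T) (z : U)
    (s : seq S) (t : seq T) i j : i < size s -> j < size t ->
  nth z [seq f a b | a <- s, b <- t] (i * size t + j) = f (nth x s i) (nth y t j).
Proof.
move=> + jt; elim: s i => //= a s IHs [_|i]; rewrite nth_cat size_map.
  by rewrite mul0n add0n jt (nth_map y).
by move=> si; rewrite mulSn -addnA [_ < size t]ltnNge leq_addr /= addKn; apply: IHs.
Qed.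

Section Instance.

Variables (n : nat) (e : rel 'I_n) (l : int) (M : {set 'I_n}).
Hypotheses (simple : simple_graph e) (cds : cluster_deletion_set e M).

Let k := #|M|.
Let w := init_mem (encode e l M).
Let cle := cl e.

Lemma w_n : w 0 = n. Proof. by []. Qed.
Lemma w_sign : w 1 = (l < 0)%R. Proof. by []. Qed.
Lemma w_abs : w 2 = absz l. Proof. by []. Qed.

Lemma w_tail i : w (3 + i) = nth 0 ([seq nat_of_bool (v \in M) | v <- enum 'I_n]
  ++ [seq nat_of_bool (e u v) | u <- enum 'I_n, v <- enum 'I_n]) i.
Proof. by []. Qed.

Lemma w_mod (v : 'I_n) : w (3 + v) = (v \in M).
Proof.
rewrite w_tail nth_cat size_map size_enum_ord ltn_ord.
by rewrite (nth_map v) ?size_enum_ord // nth_ord_enum.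
Qed.

Lemma w_adj (u v : 'I_n) : w (3 + n + u * n + v) = e u v.
Proof.
rewrite -!addnA w_tail nth_cat size_map size_enum_ord.
rewrite [_ < n]ltnNge leq_addr /= addKn.
have := nth_allpairs (fun a b => nat_of_bool (e a b)) u v 0
  (_ : u < size (enum 'I_n)) (_ : v < size (enum 'I_n)).
by rewrite !size_enum_ord !nth_ord_enum => ->.
Qed.

Lemma w_bits i : 3 <= i -> w i <= 1.
Proof.
move=> i3; rewrite -(subnKC i3) w_tail.
have [lt | ge] := ltnP (i - 3) (size ([seq nat_of_bool (v \in M) | v <- enum 'I_n]
  ++ [seq nat_of_bool (e u v) | u <- enum 'I_n, v <- enum 'I_n])); last first.
  by rewrite nth_default.
have := mem_nth 0 lt; rewrite mem_cat => /orP[/mapP[v _ ->] | /allpairsP[p [_ _ ->]]].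
  by case: (v \in M).
by case: (e _ _).
Qed.

Lemma input_size_ge : n + 3 <= input_size (encode e l M).
Proof.
rewrite /input_size /encode !big_cat /= addnC; apply: leq_add.
  by rewrite !big_cons big_nil; lia.
apply: leq_trans (leq_addr _ _); rewrite big_map -{1}(size_enum_ord n) -sum1_size.
by apply: leq_sum.
Qed.

Lemma cle_cluster u v x : u \notin M -> v \notin M -> x \notin M ->
  cle u v -> cle v x -> cle u x.
Proof.
have [e_sym e_irr] := simple.
move=> uM vM xM uv vx; rewrite /cle /cl; have [// | ux] := eqVneq u x.
pose A := [set y in ~: M | connect (del_rel e M) v y].
have AC : A \in components e M by apply/imsetP; exists v; rewrite // inE vM.
have del a b : a \notin M -> b \notin M -> cle a b -> connect (del_rel e M) a b.
  move=> aM bM /orP[/eqP -> // | ab]; apply: connect1.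
  by rewrite /del_rel aM bM.
apply: (cds AC); last exact/eqP.
  rewrite inE inE uM del //; move: uv.
  by rewrite /cle /cl eq_sym e_sym.
by rewrite inE inE xM del.
Qed.

Definition twins (u v : 'I_n) : bool := [forall x, cle u x == cle v x].

Definition repr_of (u : 'I_n) : 'I_n :=
  if u \in M then u else [arg min_(v < u | (v \notin M) && twins u v) val v].

Lemma twinsxx u : twins u u. Proof. by apply/forallP. Qed.

Lemma twinsP u v : reflect (forall x, cle u x = cle v x) (twins u v).
Proof. exact: 'forall_eqP. Qed.

Lemma repr_ofP u : u \notin M ->
  [/\ repr_of u \notin M, twins u (repr_of u) &
      forall v, v \notin M -> twins u v -> repr_of u <= v].
Proof.
move=> uM; rewrite /repr_of (negPf uM); case: arg_minnP; first by rewrite uM twinsxx.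
by move=> v /andP[vM uv] vmin; split=> // x xM ux; apply: vmin; rewrite xM.
Qed.

Lemma repr_M u : u \in M -> repr_of u = u.
Proof. by rewrite /repr_of => ->. Qed.

Lemma repr_out u : u \notin M -> repr_of u \notin M.
Proof. by case/repr_ofP. Qed.

Lemma repr_cl u x : cle (repr_of u) x = cle u x.
Proof.
have [uM | uM] := boolP (u \in M); first by rewrite repr_M.
by have [_ /twinsP ->] := repr_ofP uM.
Qed.

Lemma repr_twins u v : u \notin M -> v \notin M -> twins u v -> repr_of u = repr_of v.
Proof.
move=> uM vM /twinsP uv; have [ruM /twinsP ru umin] := repr_ofP uM.
have [rvM /twinsP rv vmin] := repr_ofP vM.
apply/val_inj/eqP; rewrite eqn_leq umin ?vmin //; apply/twinsP => x.
  by rewrite -ru uv.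
by rewrite uv rv.
Qed.

Lemma repr_idem u : repr_of (repr_of u) = repr_of u.
Proof.
have [uM | uM] := boolP (u \in M); first by rewrite !(repr_M uM).
have [rM ru _] := repr_ofP uM; apply/esym; exact: repr_twins.
Qed.

Definition items := [set u | repr_of u == u].

Definition roots := [set r | (r \notin M) && [forall u : 'I_n, (u < r) ==> (u \notin M) ==> ~~ e u r]].

Lemma roots_out r : r \in roots -> r \notin M.
Proof. by rewrite inE => /andP[]. Qed.

Lemma roots_ex u : u \notin M -> exists2 r, r \in roots & cle r u.
Proof.
have [e_sym e_irr] := simple.
move=> uM; pose P v := (v \notin M) && cle u v.
have Pu : P u by rewrite /P uM /cle /cl eqxx.
case: (arg_minnP val Pu) => r /andP[rM ur] rmin; exists r; last by rewrite /cle clC.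
rewrite inE rM; apply/forallP => v; apply/implyP => vr; apply/implyP => vM.
apply/negP => evr; have : r <= v; last by rewrite leqNgt vr.
apply: rmin; rewrite /P vM; apply: (cle_cluster uM rM vM ur).
by rewrite /cle /cl e_sym evr orbT.
Qed.

Lemma roots_uniq r r' : r \in roots -> r' \in roots -> cle r r' -> r = r'.
Proof.
have [e_sym e_irr] := simple.
rewrite !inE => /andP[rM /forallP rP] /andP[rM' /forallP rP'] /orP[/eqP // | err].
have [lt | gt | /val_inj //] := ltngtP r r'.
  by have := rP' r; rewrite lt rM err.
by have := rP r'; rewrite gt rM' e_sym err.
Qed.

(* A vertex outside [M] is determined up to twins by its clique and its
   neighbourhood in [M]. *)
Lemma card_items : #|items| <= 2 ^ k * #|components e M| + k.
Proof.
have [e_sym e_irr] := simple.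
rewrite -(cardsID M items) addnC; apply: leq_add; last first.
  exact/subset_leq_card/subsetIr.
pose block u := [set y in ~: M | connect (del_rel e M) u y].
have blockP u x : u \notin M -> x \notin M -> (x \in block u) = cle u x.
  move=> uM xM; rewrite inE inE xM /=; apply/idP/idP => [/connectP[p] | /orP[/eqP -> // | ux]].
    elim: p u uM => [|y p IHp] u uM /=; first by move=> _ ->; rewrite /cle /cl eqxx.
    case/andP=> /and3P[_ yM uy] yp lastp.
    apply: (cle_cluster uM yM xM); last exact: IHp.
    by rewrite /cle /cl uy orbT.
  by apply: connect1; rewrite /del_rel uM xM.
pose code u := (block u, mnbh e M u).
have inj : {in items :\: M &, injective code}.
  move=> u v; rewrite !inE => /andP[uM /eqP ru] /andP[vM /eqP rv] [bE mE].
  rewrite -ru -rv; apply: repr_twins => //; apply/twinsP => x.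
  have [xM | xM] := boolP (x \in M); last by rewrite -!blockP // bE.
  have := congr1 (fun S : {set 'I_n} => x \in S) mE; rewrite !inE xM /= => eE.
  rewrite /cle /cl eE; congr (_ || _).
  have -> : (u == x) = false by apply: contraNF uM => /eqP ->.
  by apply/esym; apply: contraNF vM => /eqP ->.
rewrite -(card_in_imset inj) -card_powerset mulnC -cardsX.
apply/subset_leq_card/subsetP => p /imsetP[u]; rewrite !inE => /andP[uM _] -> /=.
apply/andP; split; first by apply/imsetP; exists u; rewrite // inE uM.
by apply/subsetP => v; rewrite inE => /andP[].
Qed.

Section Rank.

Variable S : {set 'I_n}.

Definition rank (u : nat) : nat := #|[set t in S | t < u]|.

Lemma rankE u : u <= n ->
  rank u = \sum_(i < u) nat_of_bool (if insub (val i) is Some t then t \in S else false).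
Proof.
move=> un; rewrite /rank.
rewrite (big_ord_widen n (fun i => nat_of_bool (if insub i is Some t then t \in S else false)) un).
rewrite -sum1dep_card big_mkcondl /= [RHS]big_mkcond [LHS]big_mkcond /=.
by apply: eq_bigr => t _; rewrite valK; case: (t \in S); case: (t < u).
Qed.

Lemma rank_lt (s : 'I_n) u : s \in S -> s < u -> rank s < rank u.
Proof.
move=> sS su; apply/proper_card/properP; split.
  by apply/subsetP => t; rewrite !inE => /andP[-> ts]; apply: ltn_trans su.
by exists s; rewrite !inE sS ?su // ltnn.
Qed.

Lemma rank_inj (s t : 'I_n) : s \in S -> t \in S -> rank s = rank t -> s = t.
Proof.
move=> sS tS st; have [lt | gt | /val_inj //] := ltngtP s t.
  by have := rank_lt sS lt; rewrite st ltnn.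
by have := rank_lt tS gt; rewrite st ltnn.
Qed.

Lemma rank_n : rank n = #|S|.
Proof. by congr #|pred_of_set _|; apply/setP => t; rewrite inE ltn_ord andbT. Qed.

Lemma rank_lt_card (s : 'I_n) : s \in S -> rank s < #|S|.
Proof. by move=> sS; rewrite -rank_n rank_lt. Qed.

End Rank.

Variable X : nat.
Hypotheses (nX : n <= X) (X20 : 20 <= X).

Lemma ordX (u : 'I_n) : u <= X.
Proof. by apply: leq_trans nX; apply: ltnW. Qed.

Lemma hasb_ord (p : pred nat) : hasb X n p = [exists v : 'I_n, p v].
Proof.
apply/(hasbP _ nX)/existsP => [[i lt pi] | [v pv]]; first by exists (Ordinal lt).
by exists v.
Qed.

Lemma hasb_lt (p : pred nat) (u : 'I_n) : hasb X u p = [exists v : 'I_n, (v < u) && p v].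
Proof.
apply/(hasbP _ (ordX u))/existsP => [[i lt pi] | [v /andP[lt pv]]].
  by exists (Ordinal (ltn_trans lt (ltn_ord u))); rewrite /= lt.
by exists v.
Qed.

Lemma allb_ord (p : pred nat) : allb X n p = [forall v : 'I_n, p v].
Proof.
apply/(allbP _ nX)/forallP => [h v | h i lt]; first exact: h.
exact: (h (Ordinal lt)).
Qed.

Lemma sumb_card (p : pred nat) : sumb X n (fun v => nat_of_bool (p v)) = #|[set v : 'I_n | p v]|.
Proof.
rewrite sumbE // -sum1dep_card [RHS]big_mkcond.
by apply: eq_bigr => v _; case: (p v).
Qed.

Lemma in_modE (v : 'I_n) : in_mod w v = (v \in M).
Proof. by rewrite /in_mod w_mod; case: (v \in M). Qed.

Lemma adjE (u v : 'I_n) : adj X w u v = e u v.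
Proof. by rewrite /adj w_n mulE ?ordX // w_adj; case: (e u v). Qed.

Lemma cadjE (u v : 'I_n) : cadj X w u v = cle u v.
Proof. by rewrite /cadj adjE. Qed.

Lemma mod_sizeE : mod_size X w = k.
Proof.
rewrite /mod_size w_n sumb_card; congr #|pred_of_set _|.
by apply/setP => v; rewrite inE in_modE.
Qed.

Lemma kX : k <= X.
Proof. by apply: leq_trans nX; rewrite -[n]card_ord max_card. Qed.

Lemma twinE (u v : 'I_n) : twin X w u v = twins u v.
Proof. by rewrite /twin w_n allb_ord; apply: eq_forallb => x; rewrite !cadjE. Qed.

Lemma itemE (u : 'I_n) : item X w u = (u \in items).
Proof.
rewrite /item in_modE inE; have [uM | uM] := boolP (u \in M); first by rewrite repr_M ?eqxx.
rewrite hasb_lt; have [rM ru rmin] := repr_ofP uM; apply/idP/idP.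
  rewrite negb_exists => /forallP h; apply: contraT => ne.
  have := h (repr_of u); rewrite in_modE twinE rM /=.
  have -> : twins (repr_of u) u by apply/twinsP => x; rewrite repr_cl.
  by rewrite andbT ltn_neqAle ne rmin ?twinsxx.
move/eqP => ruE; apply/negP => /existsP[v]; rewrite in_modE twinE => /and3P[vu vM /twinsP tv].
have : repr_of u <= v by apply: rmin => //; apply/twinsP => x; rewrite tv.
by rewrite ruE leqNgt vu.
Qed.

Lemma repr_items u : repr_of u \in items.
Proof. by rewrite inE repr_idem. Qed.

Lemma is_repE (s u : 'I_n) : is_rep X w s u = (repr_of u == s).
Proof.
rewrite /is_rep itemE !in_modE twinE; apply/idP/idP.
  rewrite inE => /andP[/eqP rs /orP[/eqP/val_inj <- | /andP[/andP[sM uM] tw]]]; first exact/eqP.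
  by rewrite -(repr_twins sM uM tw) rs.
move/eqP => <-; rewrite repr_items.
have [uM | uM] := boolP (u \in M); first by rewrite repr_M ?eqxx.
rewrite repr_out //=; apply/orP; right; apply/twinsP => x; exact: repr_cl.
Qed.

Lemma item_rankE u : u <= n -> item_rank X w u = rank items u.
Proof.
move=> un; rewrite rankE // /item_rank sumbE; last exact: leq_trans nX.
apply: eq_bigr => i _; case: insubP => [t _ <- | ]; first by rewrite itemE.
by rewrite (leq_trans (ltn_ord i) un).
Qed.

Lemma mod_rankE u : u <= n -> mod_rank X w u = rank M u.
Proof.
move=> un; rewrite rankE // /mod_rank sumbE; last exact: leq_trans nX.
apply: eq_bigr => i _; case: insubP => [t _ <- | ]; first by rewrite in_modE.
by rewrite (leq_trans (ltn_ord i) un).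
Qed.

Lemma root_bE (r : 'I_n) : root_b X w r = (r \in roots).
Proof.
rewrite /root_b in_modE inE; congr (_ && _); rewrite hasb_lt negb_exists.
apply: eq_forallb => u; rewrite in_modE adjE !negb_and negbK.
by case: (u < r); case: (u \in M).
Qed.

Lemma in_cliqueE (r u : 'I_n) : in_clique X w r u = (u \in clique_of e M r).
Proof. by rewrite /in_clique in_modE cadjE inE. Qed.

Definition classes (g : nat) (c : 'I_k) : {set 'I_n} := [set s : 'I_n | class_b X w g c s].
Definition msubset (a : nat) : {set 'I_n} := [set v : 'I_n | subset_b X w a v].

Lemma msubset_sub a : msubset a \subset M.
Proof. by apply/subsetP => v; rewrite inE /subset_b in_modE => /andP[]. Qed.

Lemma allb_k (p : pred nat) : allb X k p = [forall c : 'I_k, p c].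
Proof.
apply/(allbP _ kX)/forallP => [h v | h i lt]; first exact: h.
exact: (h (Ordinal lt)).
Qed.

Lemma hasb_k (p : pred nat) : hasb X k p = [exists c : 'I_k, p c].
Proof.
apply/(hasbP _ kX)/existsP => [[i lt pi] | [v pv]]; first by exists (Ordinal lt).
by exists v.
Qed.

Lemma classes_card g (s : 'I_n) :
  sumb X k (fun c => nat_of_bool (class_b X w g c s)) = #|[set c | s \in classes g c]|.
Proof.
rewrite sumbE ?kX // -sum1dep_card [RHS]big_mkcond.
by apply: eq_bigr => c _; rewrite inE; case: class_b.
Qed.

Lemma fiberE (s : 'I_n) :
  sumb X n (fun u => nat_of_bool (is_rep X w s u)) = #|[set u | repr_of u == s]|.
Proof.
by rewrite sumb_card; congr #|pred_of_set _|; apply/setP => u; rewrite !inE is_repE.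
Qed.

Lemma valid_bP g : reflect (valid e M repr_of (classes g)) (valid_b X w g).
Proof.
rewrite /valid_b mod_sizeE w_n !allb_k !allb_ord.
apply: (iffP and4P) => [[/forallP h1 /forallP h2 /forallP h3 /forallP h4] | [v0 v1 v2 v3 v4]].
  split.
  - by move=> c s; rewrite inE /class_b itemE inE => /andP[/eqP].
  - move=> v vM; have := h1 v; rewrite in_modE vM hasb_k => /existsP[c cv].
    by exists c; rewrite inE.
  - move=> c s t; rewrite !inE => sc tc; have := h2 c; rewrite allb_ord => /forallP/(_ s).
    by rewrite allb_ord => /forallP/(_ t); rewrite sc tc adjE.
  - move=> c; have := h3 c; rewrite hasb_ord => /existsP[v]; rewrite allb_ord => /forallP h.
    by exists v => s; rewrite inE => sc; have := h s; rewrite sc cadjE.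
  - by move=> s _; have := h4 s; rewrite fiberE classes_card.
split; apply/forallP.
- move=> v; rewrite in_modE; apply/implyP => /v1[c cv]; rewrite hasb_k.
  by apply/existsP; exists c; rewrite inE in cv.
- move=> c; rewrite allb_ord; apply/forallP => s; rewrite allb_ord; apply/forallP => t.
  by rewrite adjE; apply/implyP => /andP[sc tc]; apply: (v2 c); rewrite inE.
- move=> c; rewrite hasb_ord; have [v vP] := v3 c; apply/existsP; exists v.
  rewrite allb_ord; apply/forallP => s; rewrite cadjE; apply/implyP => sc.
  by apply: vP; rewrite inE.
- move=> s; rewrite fiberE; have [rs | rs] := eqVneq (repr_of s) s.
    by rewrite classes_card; apply: v4.
  by rewrite sumbE ?kX // big1 // => c _; rewrite /class_b itemE inE (negPf rs).
Qed.

Lemma used_bE g : used_b X w g = used (classes g).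
Proof.
rewrite /used_b mod_sizeE sumbE ?kX // /used -sum1dep_card [RHS]big_mkcond.
apply: eq_bigr => c _; rewrite w_n hasb_ord.
suff -> : [exists v : 'I_n, class_b X w g c v] = (classes g c != set0) by case: (_ != _).
apply/existsP/set0Pn => -[s sc]; exists s; first by rewrite inE.
by rewrite inE in sc.
Qed.

Lemma nbh_sub_bE a (u : 'I_n) : nbh_sub_b X w a u = (mnbh e M u \subset msubset a).
Proof.
rewrite /nbh_sub_b w_n allb_ord; apply/forallP/subsetP => h v; have := h v.
  by rewrite !inE in_modE adjE => /implyP.
by rewrite !inE in_modE adjE => /implyP.
Qed.

Lemma rest_bE g (r : 'I_n) a : rest_b X w g r a = rest e M (classes g) r (msubset a).
Proof.
rewrite /rest_b /rest w_n mod_sizeE sumb_card; congr (_ - _).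
  congr #|pred_of_set _|; apply/setP => u; rewrite [LHS]inE [RHS]inE -nbh_sub_bE.
  by rewrite in_cliqueE.
rewrite sumbE ?kX //; apply: eq_bigr => c _; rewrite sumb_card.
congr #|pred_of_set _|; apply/setP => u; rewrite [LHS]inE [RHS]inE -nbh_sub_bE.
by rewrite in_cliqueE [u \in classes g c]inE.
Qed.

Lemma classes_surj (B : 'I_k -> {set 'I_n}) : 2 ^ (k * #|items|) <= X ->
  (forall c s, s \in B c -> s \in items) ->
  exists2 g, g < X & forall c, classes g c = B c.
Proof.
move=> pX BI; pose I := #|items|.
pose f i := nat_of_bool [exists c : 'I_k, exists s : 'I_n,
  (s \in B c) && (i == c * I + rank items s)].
have f2 i : i < k * I -> f i < 2 by rewrite /f; case: existsP.
have pX' : k * I < X by apply: leq_trans pX; apply: ltn_expl.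
exists (\sum_(i < k * I) f i * 2 ^ i).
  by apply: leq_trans pX; apply: sum_digits_lt.
move=> c; apply/setP => s; rewrite inE /class_b itemE !item_rankE ?rank_n //; last exact: ltnW.
rewrite mulE; last by apply: leq_trans kX; apply: ltnW.
have [sI | sI] := boolP (s \in items); last by apply/esym; apply: contraNF sI => /BI.
have lt : c * I + rank items s < k * I.
  have := rank_lt_card sI; have := ltn_ord c; rewrite -/I.
  move=> ck sl; apply: (@leq_trans (c.+1 * I)); first by rewrite mulSn; lia.
  by rewrite leq_mul2r ck orbT.
rewrite /= digE; first last.
- by apply: ltnW; apply: leq_trans pX; apply: sum_digits_lt.
- by apply: ltnW; apply: ltn_trans lt pX'.
- by apply: leq_trans X20.
rewrite digit_of_sum // /f lt0b; apply/existsP/idP => [[d /existsP[t /andP[td /eqP E]]] | sB].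
  have tI := BI _ _ td; have := rank_lt_card sI; have := rank_lt_card tI; rewrite -/I => tl sl.
  have cd : c = d.
    have I0 : 0 < I by apply: leq_ltn_trans sl.
    apply: val_inj; have := congr1 (divn^~ I) E.
    by rewrite /= !divnMDl // (divn_small sl) (divn_small tl) !addn0.
  by move: E; rewrite cd => /addnI/(rank_inj sI tI) ->.
by exists c; apply/existsP; exists s; rewrite sB eqxx.
Qed.

Lemma msubset_surj (A : {set 'I_n}) : 2 ^ k <= X -> A \subset M ->
  exists2 a, a < X & msubset a = A.
Proof.
move=> pX AM; pose f i := nat_of_bool [exists v : 'I_n, (v \in A) && (i == rank M v)].
have f2 i : i < k -> f i < 2 by rewrite /f; case: existsP.
exists (\sum_(i < k) f i * 2 ^ i); first by apply: leq_trans pX; apply: sum_digits_lt.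
apply/setP => v; rewrite inE /subset_b in_modE mod_rankE; last exact: ltnW.
have [vM | vM] := boolP (v \in M); last by apply/esym; apply: contraNF vM => /(subsetP AM).
have lt := rank_lt_card vM.
rewrite /= digE; first last.
- by apply: ltnW; apply: leq_trans pX; apply: sum_digits_lt.
- by apply: ltnW; apply: leq_trans lt kX.
- by apply: leq_trans X20.
rewrite digit_of_sum // /f lt0b; apply/existsP/idP => [[t /andP[tA /eqP E]] | vA].
  by rewrite (rank_inj vM (subsetP AM _ tA) E).
by exists v; rewrite vA eqxx.
Qed.

Lemma value_bE g Y : 2 ^ k <= X ->
  value_b X w g Y = objective M roots (rest e M (classes g)) (fun v => ydig X w Y v).
Proof.
move=> pX; rewrite /value_b w_n !sumbE // /objective; congr (_ + _).
  by rewrite [RHS]big_mkcond; apply: eq_bigr => v _; rewrite in_modE.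
rewrite [RHS]big_mkcond; apply: eq_bigr => r _; rewrite root_bE.
case: (r \in roots) => //.
have termE a : rest_b X w g r a - sumb X n (fun v => if subset_b X w a v then ydig X w Y v else 0)
    = rest e M (classes g) r (msubset a) - \sum_(v in msubset a) ydig X w Y v.
  rewrite rest_bE sumbE // [X in _ = _ - X]big_mkcond; congr (_ - _).
  by apply: eq_bigr => v _; rewrite inE.
rewrite /maxb minnn big_mkord; apply/eqP; rewrite eqn_leq; apply/andP; split.
  apply/bigmax_leqP => a _; rewrite termE.
  exact: (@leq_bigmax_cond _ (fun A : {set 'I_n} => A \subset M) (fun A : {set 'I_n} =>
    rest e M (classes g) r A - \sum_(v in A) ydig X w Y v) _ (msubset_sub a)).
apply/bigmax_leqP => A AM; have [a aX <-] := msubset_surj pX AM.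
rewrite -termE; exact: (@leq_bigmax _ (fun a : 'I_X => rest_b X w g r a -
  sumb X n (fun v => if subset_b X w a v then ydig X w Y v else 0)) (Ordinal aX)).
Qed.

Lemma objective_ext (c : 'I_n -> {set 'I_n} -> nat) y z :
  (forall v, v \in M -> y v = z v) -> objective M roots c y = objective M roots c z.
Proof.
move=> yz; rewrite /objective (eq_bigr _ yz); congr (_ + _); apply: eq_bigr => r _.
apply: eq_bigr => A AM; congr (_ - _); apply: eq_bigr => v vA.
exact: yz (subsetP AM v vA).
Qed.

Lemma objective0 (B : 'I_k -> {set 'I_n}) : objective M roots (rest e M B) (fun=> 0) <= n.
Proof.
have [e_sym e_irr] := simple.
rewrite /objective big1 // add0n.
apply: (@leq_trans (\sum_(r in roots) #|clique_of e M r|)).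
  apply: leq_sum => r _; apply/bigmax_leqP => A _; rewrite leq_subLR.
  apply: leq_trans (leq_subr _ _) _; apply: leq_trans (leq_addl _ _).
  by apply/subset_leq_card/subsetP => u; rewrite inE => /andP[].
rewrite (eq_bigr (fun r => \sum_(u : 'I_n) (u \in clique_of e M r))); last first.
  by move=> r _; rewrite -sum1_card big_mkcond; apply: eq_bigr => u _; case: (_ \in _).
rewrite exchange_big /= -[leqRHS]card_ord -sum1_card; apply: leq_sum => u _.
have [none | [r rR ur]] : {in roots, forall r, u \notin clique_of e M r} \/
    exists2 r, r \in roots & u \in clique_of e M r.
  case: (boolP [exists r in roots, u \in clique_of e M r]) => [/exists_inP | ]; first by right.
  by rewrite negb_exists_in => /forall_inP; left.
  by rewrite big1 // => r /none /negPf ->.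
rewrite (bigD1 r) //= ur big1 // => r' /andP[rR' rr'].
case: (boolP (u \in _)) => // ur'; case/eqP: rr'.
have ru := root_uniq e_sym cle_cluster roots_out roots_ex roots_uniq.
by rewrite -(ru r u) // -(ru r' u).
Qed.

Hypothesis n_lt : n < X.
Hypothesis pkX : 2 ^ k <= X.
Hypothesis bitsX : 16 * 2 ^ k <= X.
Hypothesis pEX : (2 ^ (16 * 2 ^ k)) ^ k <= X.

Lemma ydigE Y v : Y < n.+1 ^ n -> v < n -> ydig X w Y v = (Y %/ n.+1 ^ v) %% n.+1.
Proof.
move=> YW vn; rewrite /ydig w_n iterbE; last by apply: leq_trans nX; apply: leq_subr.
have P0 i : 0 < n.+1 ^ i by rewrite expn_gt0.
have powE i : i <= n -> powb X n.+1 i = n.+1 ^ i.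
  by move=> le; rewrite powbE //; apply: leq_trans nX.
have step i : i <= n - v.+1 ->
    iteri i (fun i r => modb X r (powb X n.+1 (n - i.+1))) Y = Y %% n.+1 ^ (n - i).
  elim: i => [_ | i IHi le] /=; first by rewrite subn0 modn_small.
  rewrite IHi; last exact: ltnW.
  have E : n - i = (n - i.+1).+1 by lia.
  rewrite powE; last exact: leq_subr.
  rewrite modbE //; first by rewrite modn_dvdm // dvdn_exp2l // E.
  rewrite -ltnS ltn_divLR // E.
  apply: (@leq_trans (n.+1 ^ (n - i.+1).+1)); first by rewrite ltn_mod.
  by rewrite expnS leq_mul2r ltnW ?orbT.
rewrite step // powE; last exact: ltnW.
have -> : n - (n - v.+1) = v.+1 by lia.
rewrite expnS modn_divl // divbE //.
rewrite -ltnS ltn_divLR //.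
apply: (@leq_trans (n.+1 * n.+1 ^ v)); first by rewrite ltn_mod muln_gt0 P0.
by rewrite leq_mul2r ltnW ?orbT.
Qed.

Lemma clip_le Y x v : clip_b X w Y x v <= n.
Proof. by rewrite /clip_b w_n; case: ifP => // _; case: ifP. Qed.

Lemma cand_sum Y x : cand_b X w Y x = \sum_(v < n) clip_b X w Y x v * n.+1 ^ v.
Proof.
rewrite /cand_b w_n sumbE //; apply: eq_bigr => v _.
rewrite mulE; last exact: leq_trans (clip_le _ _ _) nX.
by rewrite powbE // ordX.
Qed.

Lemma cand_lt Y x : cand_b X w Y x < n.+1 ^ n.
Proof.
rewrite cand_sum; apply: (@sum_digits_lt _ _ (clip_b X w Y x)) => v _.
by rewrite ltnS clip_le.
Qed.

Lemma ydig_cand Y x v : v < n -> ydig X w (cand_b X w Y x) v = clip_b X w Y x v.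
Proof.
move=> vn; rewrite ydigE ?cand_lt // cand_sum.
by apply: (@digit_of_sum _ _ (clip_b X w Y x)) => // i _; rewrite ltnS clip_le.
Qed.

Lemma digit_bitsE : digit_bits X w = 16 * 2 ^ k.
Proof. by rewrite /digit_bits mod_sizeE double4E pow2E // kX. Qed.

Lemma bound1E : bound1 X w = n + 16 * 2 ^ k.
Proof. by rewrite /bound1 digit_bitsE. Qed.

Lemma bound2E : bound2 X w = (n + 20) * 2 ^ (k * (#|items| + 16 * 2 ^ k)).
Proof.
have IX : #|items| <= X by apply: leq_trans nX; rewrite -[leqRHS]card_ord max_card.
rewrite /bound2 mod_sizeE digit_bitsE w_n item_rankE // rank_n iterbE ?kX //.
set b := 16 * 2 ^ k; elim: {1 2}k => [|i /= ->]; first by rewrite /= muln1.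
by rewrite !iterbE // !iteri_double mulSn !expnD; ring.
Qed.

Section Search.

Variable g : nat.

Let obj y := objective M roots (rest e M (classes g)) y.
Let V Y := value_b X w g Y.

Let VE Y : V Y = obj (fun v => ydig X w Y v).
Proof. exact: value_bE. Qed.

Lemma local_optimum Y : Y < n.+1 ^ n -> V Y <= n ->
  (forall x, x < X -> V Y <= V (cand_b X w Y x)) -> forall y, V Y <= obj y.
Proof.
move=> YW Vn opt ys; rewrite leqNgt; apply/negP; rewrite VE => /improving_step[y' lt close].
set h := 2 ^ (16 * 2 ^ k - 1); set E := 2 ^ (16 * 2 ^ k).
have k0 : 0 < 2 ^ k by rewrite expn_gt0.
have Eh : E = h + h by rewrite /E /h addnn -mul2n -expnS; congr (_ ^ _); lia.
have Dh : 2 ^ (12 * 2 ^ k) < h by rewrite /h ltn_exp2l //; lia.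
have pE : pow2 X (digit_bits X w) = E by rewrite digit_bitsE pow2E.
have ph : pow2 X (digit_bits X w - 1) = h.
  by rewrite digit_bitsE pow2E //; apply: leq_trans bitsX; apply: leq_subr.
have pEk : E ^ k <= X := pEX.
have E0 : 0 < E by rewrite expn_gt0.
clearbody E h.
pose z (v : 'I_n) := y' v + h - ydig X w Y v.
have zE (v : 'I_n) : v \in M -> z v < E /\ ydig X w Y v + z v - h = y' v.
  by move=> vM; have := close v vM; rewrite /z Eh -/k; lia.
pose f j := if [pick v in M | rank M v == j] is Some v then z v else 0.
have fz (v : 'I_n) : v \in M -> f (rank M v) = z v.
  move=> vM; rewrite /f; case: pickP => [t /andP[tM /eqP tv] | /(_ v)].
    by rewrite (rank_inj tM vM tv).
  by rewrite /= vM eqxx.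
have fE j : j < k -> f j < E.
  move=> _; rewrite /f; case: pickP => [t /andP[tM _] | _]; first by case: (zE t tM).
  exact: E0.
pose x := \sum_(j < k) f j * E ^ j.
have xX : x < X by apply: leq_trans pEk; apply: sum_digits_lt.
have lt' : obj y' < V Y by rewrite VE.
have y'n (v : 'I_n) : v \in M -> y' v <= n.
  move=> vM; apply: leq_trans (leq_trans (ltnW lt') Vn).
  by apply: leq_trans (leq_addr _ _); rewrite (bigD1 v) //= leq_addr.
have clipE (v : 'I_n) : v \in M -> clip_b X w Y x v = y' v.
  move=> vM; rewrite /clip_b in_modE vM w_n.
  suff -> : shift_b X w Y x v = y' v by rewrite y'n.
  have [zlt zy] := zE v vM.
  have kpos : 0 < k by apply: leq_ltn_trans (rank_lt_card vM).
  rewrite /shift_b pE ph mod_rankE; last exact: ltnW.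
  have rX : rank M v <= X by apply: leq_trans kX; apply: ltnW (rank_lt_card vM).
  have EX : 0 < E <= X.
    by rewrite E0; apply: leq_trans pEk; rewrite -[leqLHS]expn1 leq_pexp2l.
  rewrite (digE EX rX (ltnW xX)) /x.
  by rewrite digit_of_sum // ?fz // rank_lt_card.
have := opt x xX; rewrite leqNgt => /negP; apply.
apply: leq_ltn_trans lt'; rewrite VE; apply/eq_leq; apply: objective_ext => v vM.
by rewrite ydig_cand // clipE.
Qed.

Let try_le x Y : V (try_b X w g x Y) <= V Y.
Proof. by rewrite /try_b; case: ltnP => // /ltnW. Qed.

Let try_eq x Y : V (try_b X w g x Y) = V Y ->
  try_b X w g x Y = Y /\ V Y <= V (cand_b X w Y x).
Proof. by rewrite /try_b -!/(V _); case: ltnP => // lt E; rewrite E ltnn in lt. Qed.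

Let tries_le j Y : V (iteri j (fun x Z => try_b X w g x Z) Y) <= V Y.
Proof. by elim: j => //= j IHj; apply: leq_trans (try_le _ _) IHj. Qed.

Let tries_eq j Y : V (iteri j (fun x Z => try_b X w g x Z) Y) = V Y ->
  iteri j (fun x Z => try_b X w g x Z) Y = Y /\
  forall x, x < j -> V Y <= V (cand_b X w Y x).
Proof.
elim: j => //= j IHj E.
have Ej : V (iteri j (fun x Z => try_b X w g x Z) Y) = V Y.
  by apply/eqP; rewrite eqn_leq tries_le -{1}E try_le.
have [itE cE] := IHj Ej; rewrite itE in E *; have [tE cj] := try_eq E.
split; first exact: tE.
by move=> x; rewrite ltnS leq_eqVlt => /predU1P[-> | /cE]; [exact: cj | apply].
Qed.

Let tries_lt j Y : Y < n.+1 ^ n -> iteri j (fun x Z => try_b X w g x Z) Y < n.+1 ^ n.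
Proof.
move=> YW; elim: j => //= j IHj; rewrite {1}/try_b; case: ifP => // _; exact: cand_lt.
Qed.

Lemma search_opt y : V (search_b X w g) <= obj y.
Proof.
rewrite /search_b iterbE //; set rounds := iteri X _ 0.
pose Y j := iteri j (fun _ Y => round_b X w g Y) 0.
have roundE Z : round_b X w g Z = iteri X (fun x Z => try_b X w g x Z) Z.
  by rewrite /round_b iterbE.
have YW j : Y j < n.+1 ^ n.
  elim: j => [|j IHj]; first by rewrite /= expn_gt0.
  by rewrite /= roundE tries_lt.
have V0 : V (Y 0) <= n.
  apply: leq_trans (objective0 (classes g)); rewrite VE; apply/eq_leq.
  by apply: objective_ext => v _; rewrite ydigE ?expn_gt0 // div0n mod0n.
have Vmono j : V (Y j.+1) <= V (Y j) by rewrite /= roundE tries_le.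
have Vn j : V (Y j) <= n by elim: j => // j; apply: leq_trans (Vmono j).
have prog j : V (Y j) + j <= n \/ forall z, V (Y j) <= obj z.
  elim: j => [|j [IHj | IHj]]; first by left; rewrite addn0.
    have [lt | ge] := ltnP (V (Y j.+1)) (V (Y j)); first by left; lia.
    right=> z; apply: leq_trans (Vmono j) _; apply: local_optimum => //.
    have := @tries_eq X (Y j); rewrite -roundE => h.
    by have [|_] := h; first by apply/eqP; rewrite eqn_leq ge Vmono.
  by right=> z; apply: leq_trans (Vmono j) (IHj z).
by case: (prog X) => [le | ]; [move: n_lt le; lia | apply].
Qed.

End Search.

Hypothesis pIX : 2 ^ (k * #|items|) <= X.

Lemma answerP : answer X w <-> cd_colorable e l.
Proof.
have [e_sym e_irr] := simple.
rewrite /answer w_sign w_abs.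
have [l0 | l0] := boolP (l < 0)%R.
  by split=> // -[C [chi [_ h]]]; lia.
split.
  case/andP=> _ /(hasbP _ (leqnn X))[g gX /andP[/valid_bP vg]].
  rewrite used_bE value_bE // => le.
  have [C [chi [chiP chil]]] := sound e_sym e_irr cle_cluster roots_out roots_ex roots_uniq
    repr_M repr_out repr_cl (fun v => ydig X w (search_b X w g) v) vg.
  exists C, chi; split=> //; have := leq_trans chil le; lia.
case=> C [chi [chiP chil]] /=.
have [B [z [Bv Bl]]] := complete e_sym e_irr cle_cluster roots_out roots_ex roots_uniq
    repr_idem repr_M repr_out repr_cl chiP (erefl k).
have BI c s : s \in B c -> s \in items by case: Bv => v0 _ _ _ _ /v0 sE; rewrite inE sE.
have [g gX gB] := classes_surj pIX BI.
have {gB} gB : classes g = B by apply: functional_extensionality.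
apply/(hasbP _ (leqnn X)); exists g => //; apply/andP; split; first by apply/valid_bP; rewrite gB.
rewrite used_bE gB; have := search_opt g z; rewrite gB => le.
apply: leq_trans (_ : #|colors chi| <= _); last by lia.
by apply: leq_trans Bl; rewrite leq_add2l.
Qed.

End Instance.

Lemma bound1_le_bound2 (n k I : nat) :
  n + 16 * 2 ^ k <= (n + 20) * 2 ^ (k * (I + 16 * 2 ^ k)).
Proof.
case: (posnP k) => [-> | kpos]; first by rewrite mul0n !expn0; lia.
have : 16 * 2 ^ k <= 2 ^ (k * (I + 16 * 2 ^ k)).
  apply: (@leq_trans (2 ^ (16 * 2 ^ k))); first by apply: ltnW; apply: ltn_expl.
  rewrite leq_exp2l //; apply: leq_trans (leq_pmull _ kpos); exact: leq_addl.
have : 0 < 2 ^ (k * (I + 16 * 2 ^ k)) by rewrite expn_gt0.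
set P := 2 ^ (k * _); set t := 16 * _; clearbody P t; nia.
Qed.

Lemma scaled_le (n k I q : nat) : I <= 2 ^ k * q + k ->
  (n + (n + 16 * 2 ^ k) + (n + 20) * 2 ^ (k * (I + 16 * 2 ^ k))).+1 <=
    60 * (n + 3) * 2 ^ (10 * (2 ^ k * k * qlogq q)).
Proof.
move=> hI; set X1 := n + 16 * 2 ^ k; set X2 := (n + 20) * _.
have k2 : k < 2 ^ k by apply: ltn_expl.
have hq : q + 17 <= 10 * qlogq q.
  rewrite /qlogq; have l0 : 0 < trunc_log 2 (maxn q 2) by apply: trunc_log_max => //; lia.
  have : maxn q 2 <= maxn q 2 * trunc_log 2 (maxn q 2) by rewrite leq_pmulr.
  by lia.
have leE : k * (I + 16 * 2 ^ k) <= 10 * (2 ^ k * k * qlogq q).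
  have -> : 10 * (2 ^ k * k * qlogq q) = k * (2 ^ k * (10 * qlogq q)) by ring.
  rewrite leq_mul2l; apply/orP; right.
  apply: (@leq_trans (2 ^ k * (q + 17))); last by rewrite leq_mul2l hq orbT.
  by rewrite mulnDr; lia.
have X1X2 : X1 <= X2 := bound1_le_bound2 n k I.
have X2n : n + 20 <= X2 by rewrite leq_pmulr // expn_gt0.
apply: (@leq_trans (3 * X2)); first by lia.
rewrite /X2 mulnA; apply: leq_mul; first by lia.
by rewrite leq_exp2l.
Qed.

Theorem theorem14 :
  exists (p : cmd) (a c d : nat),
  forall (n : nat) (e : rel 'I_n) (l : int) (M : {set 'I_n}),
    simple_graph e ->
    cluster_deletion_set e M ->
    let w := encode e l M in
    let k := #|M| in
    let q := #|components e M| in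
    decides_within p w (cd_colorable e l)
      (2 ^ (a * (2 ^ k * k * qlogq q)) * (c * input_size w ^ d)).
Proof.
have [e1 h1] := computable_bound1; have [e2 h2] := computable_bound2.
have [e3 h3] := computable_answer; have [p [c pP]] := staged_program e1 e2 e3.
exists p, (10 * c), (c * 60 ^ c), c => n e l M sg cds w k q.
pose m := init_mem w.
have := pP m (@w_bits n e l M); cbv zeta; rewrite h1 h2 h3.
have X1E : bound1 (m 0) m = n + 16 * 2 ^ k by apply: bound1E.
have X2E : bound2 (n + 16 * 2 ^ k) m =
    (n + 20) * 2 ^ (k * (#|items e M| + 16 * 2 ^ k)).
  by apply: bound2E; rewrite ?leq_addr ?leq_addl.
rewrite X1E X2E; set X2 := (n + 20) * _.
have hI : #|items e M| <= 2 ^ k * q + k by apply: card_items.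
have := scaled_le n hI; rewrite -/X2 => leX [t [m' [ex tT m'0]]].
have P0 : 0 < 2 ^ (k * (#|items e M| + 16 * 2 ^ k)) by rewrite expn_gt0.
have X2n : n + 20 <= X2 by rewrite leq_pmulr.
have X1X2 : n + 16 * 2 ^ k <= X2 := bound1_le_bound2 n k _.
have powX j : j <= k * (#|items e M| + 16 * 2 ^ k) -> 2 ^ j <= X2.
  by move=> le; apply: leq_trans (leq_pmull _ _); rewrite ?leq_exp2l // addn_gt0 orbT.
exists t, m'; split=> //.
  rewrite m'0 lt0b; apply: answerP => //; try by [lia | move: X1X2; rewrite -/k; lia].
  - by rewrite -expnM powX // mulnC leq_mul2l leq_addl orbT.
  - by rewrite powX // leq_mul2l leq_addr orbT.
apply: leq_trans tT _.
have size_ge := input_size_ge e l M; rewrite -/w in size_ge.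
rewrite mulnCA mulnA -mulnA -mulnA; apply: leq_mul => //.
have -> : 10 * c * (2 ^ k * k * qlogq q) = 10 * (2 ^ k * k * qlogq q) * c by ring.
rewrite expnM -!expnMn; case: (posnP c) => [-> // | c0].
rewrite leq_exp2r //; apply: leq_trans leX _.
set P := 2 ^ _; set s := input_size w in size_ge *; clearbody P s.
have : (n + 3) * P <= s * P by rewrite leq_mul2r size_ge orbT.
by lia.
Qed.
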